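(* Let $N\ge3$, $\alpha\ge 0$, $B$ the unit ball of $\mathbb{R}^N$, $p_\alpha=\frac{N+2+2\alpha}{N-2}$, and for $p\in(1,p_\alpha)$ let $u_p$ be any radial solution of $-\Delta u=|x|^\alpha|u|^{p-1}u$ in $B$, $u=0$ on $\partial B$, with exactly $m\ge1$ nodal zones. Let $0<r_{1,p}<\dots<r_{m,p}=1$ be the radii of the zeros of $u_p$, $A_{0,p}=\{|x|<r_{1,p}\}$, $A_{i,p}=\{r_{i,p}<|x|<r_{i+1,p}\}$ for $i=1,\dots,m-1$, $\mu_{i,p}=\max_{A_{i,p}}|u_p|$, $\sigma_{i,p}$ the radius at which $|u_p|$ attains $\mu_{i,p}$ in $A_{i,p}$, $\widetilde\mu_{i,p}=\mu_{i,p}^{\frac{p-1}{2+\alpha}}$, $\widetilde A_{i,p}=\{x: x/\widetilde\mu_{i,p}\in A_{i,p}\}$, and \[ \widetilde u_{i,p}(x)=\frac{1}{\mu_{i,p}}\Big|u_p\Big(\frac{x}{\widetilde\mu_{i,p}}\Big)\Big|,\qquad x\in\widetilde A_{i,p}. \] Let $U_\alpha(x)=\Big(1+\frac{|x|^{2+\alpha}}{(N+\alpha)(N-2)}\Big)^{-\frac{N-2}{2+\alpha}}$. Then as $p\to p_\alpha$: $\mu_{i,p}\to+\infty$ for $i=0,\dots,m-1$; $\widetilde u_{0,p}\to U_\alpha$ in $C^1_{\mathrm{loc}}(\mathbb{R}^N)$; and, if $m\ge2$, for $i=1,\dots,m-1$ one has $r_{i,p}\to0$, $\sigma_{i,p}\to0$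 and $\widetilde u_{i,p}\to U_\alpha$ in $C^1_{\mathrm{loc}}(\mathbb{R}^N\setminus\{0\})$.
   Context: A nodal zone of $u$ is a connected component of $\{x\in B:u(x)\ne0\}$. $U_\alpha$ is the unique radial bounded positive solution of $-\Delta U=|x|^\alpha U^{p_\alpha}$ in $\mathbb{R}^N$ with $U(0)=1$. *)

(* Defs.v *)
From HB Require Import structures.
From mathcomp Require Import all_boot all_order all_algebra.
From mathcomp Require Import all_classical all_reals all_analysis.
Set Implicit Arguments. Unset Strict Implicit. Unset Printing Implicit Defensive.
Import Order.TTheory GRing.Theory Num.Theory.
Import numFieldNormedType.Exports.
Local Open Scope classical_set_scope.
Local Open Scope ring_scope.

Section Defs.
Variables (R : realType) (N : nat).
Local Notation V := 'rV[R]_N.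

(* Euclidean norm |x| on R^N (the library norm on matrices is the sup norm) *)
Definition enorm (x : V) : R := Num.sqrt (\sum_(i < N) x ord0 i ^+ 2).

Definition evec (j : 'I_N) : V := delta_mx ord0 j.

Definition unit_ball : set V := [set x | enorm x < 1].

Definition laplacian (u : V -> R) (x : V) : R :=
  \sum_(i < N) 'D_(evec i) ('D_(evec i) u) x.

(* classical solution u in C^2(B) cap C(closure B) of
   -Delta u = |x|^alpha |u|^(p-1) u in B, u = 0 on boundary of B *)
Definition dirichlet_solution (alpha p : R) (u : V -> R) : Prop :=
  [/\ (forall x, enorm x <= 1 -> {for x, continuous u}),
      (forall x, enorm x = 1 -> u x = 0),
      (forall x, unit_ball x -> differentiable u x),
      (forall i x, unit_ball x -> differentiable ('D_(evec i) u) x) &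
      (forall x, unit_ball x ->
          - laplacian u x = enorm x `^ alpha * (`|u x| `^ (p - 1) * u x))]
  /\ (forall i j x, unit_ball x ->
          {for x, continuous ('D_(evec j) ('D_(evec i) u))}).

Definition radial (u : V -> R) : Prop :=
  forall x y, enorm x = enorm y -> u x = u y.

Definition nodal_zones (u : V -> R) : set (set V) :=
  let O := [set x | unit_ball x /\ u x != 0] in
  [set C | exists2 x, O x & C = connected_component O x].

Definition nodal_annulus (r : nat -> R) (i : nat) : set V :=
  if i == 0%N then [set x | enorm x < r 1%N]
  else [set x | r i < enorm x < r i.+1].

Definition U_alpha (alpha : R) (x : V) : R :=
  (1 + enorm x `^ (2 + alpha) / ((N%:R + alpha) * (N%:R - 2)))
    `^ (- ((N%:R - 2) / (2 + alpha))).

Definition C1loc_conv (F : set_system R) (D : R -> set V)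
    (f : R -> V -> R) (g : V -> R) : Prop :=
  forall (rad eps : R), 0 < rad -> 0 < eps ->
  \forall p \near F, forall x, enorm x <= rad ->
    [/\ D p x, `|f p x - g x| < eps &
        forall j, `|'D_(evec j) (f p) x - 'D_(evec j) g x| < eps].

Definition C1loc_conv_punct (F : set_system R) (D : R -> set V)
    (f : R -> V -> R) (g : V -> R) : Prop :=
  forall (rho rad eps : R), 0 < rho -> 0 < eps ->
  \forall p \near F, forall x, rho <= enorm x <= rad ->
    [/\ D p x, `|f p x - g x| < eps &
        forall j, `|'D_(evec j) (f p) x - 'D_(evec j) g x| < eps].

End Defs.

(* Main.v *)
Require Import Defs.
From HB Require Import structures.
From mathcomp Require Import all_boot all_order all_algebra.
From mathcomp Require Import all_classical all_reals all_analysis.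
From mathcomp Require Import ring lra.
Import Order.TTheory GRing.Theory Num.Theory.
Import numFieldNormedType.Exports.
Local Open Scope classical_set_scope.
Local Open Scope ring_scope.

Set Implicit Arguments.
Unset Strict Implicit.
Unset Printing Implicit Defensive.

(* Writing [u x = phi |x|], the profile solves
   [phi'' + (n-1)/t phi' + t^alpha |phi|^(p-1) phi = 0] on ]0,1[, and each nodal
   zone, rescaled by its maximum, is a positive solution [V] with [V s = 1],
   [V' s = 0], vanishing at some [b > s].  As [p] tends to the critical exponent
   and [s] tends to 0, a Gronwall estimate gives [V -> U] in C^1 on bounded sets,
   hence [b -> oo].  It remains to propagate [s -> 0] from one zone to the next.

   A Pohozaev-type quantity is nonnegative along [V], so that the ratio
   [- V' t^-(1+alpha) V^-((n+alpha)/(n-2))] increases (Atkinson-Peletier).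
   Integrating, [V <= C t^(2-n)] up to [b], and the flux [K = - b^(n-1) V'(b)]
   through the zero [b] stays bounded.  In the next zone, with extremum [- M]
   attained at [sg], the flux decreases from [K] to 0, whence [M <= K b^(2-n)]
   and [sg^(n+alpha) M^p <= C K].  Since [b -> oo], interpolating between these two
   bounds gives [sg M^((p-1)/(2+alpha)) -> 0], which is the new value of [s]. *)

(** * Calculus on the real line *)

(** Convergence on bounded sets says nothing about [b] itself, which escapes to infinity, so the
    decay estimate needs constants independent of [p] and [b]. Its source: for the limit profile,
    [U^(-(2+alpha)/(n-2))] is an affine function of [t^(2+alpha)]. For a subcritical zone the same
    power of [V] is convex in [t^(2+alpha)], so it stays above a line whose slope is read off at
    [t = 1], where convergence is already known. The flux is the natural carrier of information
    across a zero because it is constant for radial harmonic functions, that is for [t^(2-n)], and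
    its derivative is only the source term. The interpolation has room to spare. Put
    [e = (p-1)/(2+alpha)]. At the critical exponent [e (n-2) = 2] and
    [e - p/(n+alpha) = 1/(n+alpha)], so each regime, [sg] comparable to [b] or much larger, leaves a
    strictly negative power of [b] for [p] close to critical. The remaining limits follow from
    [b -> oo]: since [r_(i+1) <= 1], the outer zero of a rescaled zone is at most its scale, so
    scales and maxima blow up; an extremum whose rescaled radius tends to 0 then has its true
    radius, and that of the zero before it, tending to 0. *)

Section Der.
Context {R : realType}.
Implicit Types (f g : R -> R) (x a b : R).

Lemma drv_eq {f x a b} : is_derive x 1 f a -> a = b -> is_derive x 1 f b.
Proof. by move=> ? <-. Qed.

Lemma drv_cst c x : is_derive x (1:R) (fun _ : R => c : R) 0.
Proof. exact: is_derive_cst. Qed.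

Lemma drv_id x : is_derive x (1:R) (fun t : R => t) 1.
Proof. exact: is_derive_id. Qed.

Lemma drv_add f g x a b : is_derive x 1 f a -> is_derive x 1 g b ->
  is_derive x 1 (fun t => f t + g t) (a + b).
Proof. by move=> ? ?; exact: is_deriveD. Qed.

Lemma drv_opp f x a : is_derive x 1 f a -> is_derive x 1 (fun t => - f t) (- a).
Proof. by move=> ?; exact: is_deriveN. Qed.

Lemma drv_mul f g x a b : is_derive x 1 f a -> is_derive x 1 g b ->
  is_derive x 1 (fun t => f t * g t) (f x * b + g x * a).
Proof. by move=> ? ?; exact: is_deriveM. Qed.

Lemma drv_sqr f x a : is_derive x 1 f a ->
  is_derive x 1 (fun t => f t ^+ 2) (2 * f x * a).
Proof.
move=> fa; have -> : (fun t => f t ^+ 2) = (fun t => f t * f t) by apply/funext.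
by apply: drv_eq (drv_mul fa fa) _; ring.
Qed.

Lemma drv_comp f g x a b : is_derive (f x) 1 g b -> is_derive x 1 f a ->
  is_derive x 1 (fun t => g (f t)) (b * a).
Proof. by move=> gb fa; exact: (@is_derive1_comp R g f x b a). Qed.

Lemma drv_inverse f x a : f x != 0 -> is_derive x 1 f a ->
  is_derive x 1 (fun t => (f t)^-1) (- (f x) ^- 2 * a).
Proof. by move=> ? ?; exact: is_deriveV. Qed.

Lemma drv_powR f x a c : 0 < f x -> is_derive x 1 f a ->
  is_derive x 1 (fun t => f t `^ c) (c * (f x `^ c / f x) * a).
Proof.
move=> f0 fa; apply: (drv_comp (g := fun t => t `^ c)) => //.
have := is_derive1_powR c f0.
by rewrite powRB ?(gt_eqF f0) ?implybT // powRr1 // ltW.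
Qed.

Lemma drv_expR f x a : is_derive x 1 f a ->
  is_derive x 1 (fun t => expR (f t)) (expR (f x) * a).
Proof. by move=> fa; exact: (drv_comp (g := expR)). Qed.

Lemma drv_near f g x a : (\near x, f x = g x) -> is_derive x 1 f a ->
  is_derive x 1 g a.
Proof. by move=> fg; apply: near_eq_is_derive. Qed.

Lemma drv_continuous f x a : is_derive x 1 f a -> {for x, continuous f}.
Proof.
by case=> fd _; apply: differentiable_continuous; apply/derivable1_diffP.
Qed.

Lemma MVTc f (df : R -> R) a b : a < b ->
  (forall x, a < x < b -> is_derive x 1 f (df x)) ->
  {for a, continuous f} -> {for b, continuous f} ->
  exists2 c, a < c < b & f b - f a = df c * (b - a).
Proof.
move=> ab fd fa fb.
have [c cab fE] : exists2 c, c \in `]a, b[%R & f b - f a = df c * (b - a).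
  apply: MVT => //.
  apply: continuous_in_subspaceT => x; rewrite inE /= in_itv /= => /andP[].
  rewrite le_eqVlt => /predU1P[<- _ //|ax].
  rewrite le_eqVlt => /predU1P[-> //|xb].
  by apply: drv_continuous (fd x _); rewrite ax.
by exists c => //; rewrite in_itv in cab.
Qed.

Lemma drv_nincr f (df : R -> R) a b : a <= b ->
  (forall x, a < x < b -> is_derive x 1 f (df x)) ->
  (forall x, a < x < b -> df x <= 0) ->
  {for a, continuous f} -> {for b, continuous f} -> f b <= f a.
Proof.
rewrite le_eqVlt => /predU1P[<- //|ab] fd df0 fa fb.
have [c cab fE] := MVTc ab fd fa fb.
have := df0 c cab; nra.
Qed.

Lemma drv_ndecr f (df : R -> R) a b : a <= b ->
  (forall x, a < x < b -> is_derive x 1 f (df x)) ->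
  (forall x, a < x < b -> 0 <= df x) ->
  {for a, continuous f} -> {for b, continuous f} -> f a <= f b.
Proof.
rewrite le_eqVlt => /predU1P[<- //|ab] fd df0 fa fb.
have [c cab fE] := MVTc ab fd fa fb.
have := df0 c cab; nra.
Qed.

Lemma no_zero_sign f a b : (forall x, a < x < b -> {for x, continuous f}) ->
  (forall x, a < x < b -> f x != 0) ->
  forall x y, a < x < b -> a < y < b -> 0 < f x -> 0 < f y.
Proof.
move=> fc f0.
have key x y : a < x < b -> a < y < b -> x <= y ->
    Num.min (f x) (f y) <= 0 <= Num.max (f x) (f y) -> False.
  move=> /andP[ax xb] /andP[ay yb] xy H.
  have [z] : exists2 z, z \in `[x, y]%R & f z = 0.
    apply: IVT => //.
    apply: continuous_in_subspaceT => z; rewrite inE /= in_itv /= => /andP[xz zy].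
    by apply: fc; rewrite (lt_le_trans ax) // (le_lt_trans zy).
  rewrite in_itv /= => /andP[xz zy] fz.
  have := f0 z; rewrite fz eqxx (lt_le_trans ax) // (le_lt_trans zy) //.
  by move=> /(_ isT).
move=> x y hx hy fx; rewrite ltNge; apply/negP => fy.
have [xy|/ltW yx] := leP x y.
- by apply: (key x y); rewrite // ge_min le_max fy orbT (ltW fx).
- by apply: (key y x); rewrite // ge_min le_max fy (ltW fx) orbT.
Qed.

Lemma cont_epsP f x : {for x, continuous f} <->
  forall e, 0 < e -> exists2 d, 0 < d & forall y, `|y - x| < d -> `|f y - f x| < e.
Proof.
split=> [fx e e0|H].
  have /cvgrPdist_lt/(_ _ e0) := fx.
  move=> /nbhs_ballP[d /= d0 H]; exists d => // y yx.
  by rewrite distrC; apply: H; rewrite /ball /= distrC.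
apply/cvgrPdist_lt => e e0; have [d d0 {}H] := H e e0.
apply/nbhs_ballP; exists d => //= y; rewrite /ball /= => yx.
by rewrite distrC; apply: H; rewrite distrC.
Qed.

Lemma powRS1 x c : 0 < x -> x `^ (1 + c) = x * x `^ c.
Proof. by move=> x0; rewrite powRD ?(gt_eqF x0) ?implybT ?powRr1 ?(ltW x0). Qed.

Lemma powRS2 x c : 0 < x -> x `^ (2 + c) = x ^+ 2 * x `^ c.
Proof.
move=> x0; rewrite powRD ?(gt_eqF x0) ?implybT //; congr (_ * _).
by rewrite -(powR_mulrn 2 (ltW x0)).
Qed.

Lemma powRP1 x c : 0 < x -> x `^ (c - 1) = x `^ c / x.
Proof. by move=> x0; rewrite powRB ?(gt_eqF x0) ?implybT ?powRr1 ?(ltW x0). Qed.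

Lemma cont_normpowR0 c : 1 <= c -> {for 0, continuous (fun t : R => `|t| `^ c)}.
Proof.
move=> c1; have c0 : c != 0 by rewrite gt_eqF // (lt_le_trans ltr01).
apply/cont_epsP => e e0; exists (Num.min e 1) => [|y].
  by rewrite lt_min e0 ltr01.
rewrite subr0 lt_min normr0 powR0 // subr0.
move=> /andP[ye y1]; rewrite ger0_norm ?powR_ge0 //.
have [->|y0] := eqVneq y 0; first by rewrite normr0 powR0.
by apply: le_lt_trans ye; rewrite ge1r_powR // normr_gt0 y0 ltW.
Qed.

Lemma cont_mul f g x : {for x, continuous f} -> {for x, continuous g} ->
  {for x, continuous (fun t => f t * g t)}.
Proof. by move=> ? ?; exact: cvgM. Qed.

Lemma cont_add f g x : {for x, continuous f} -> {for x, continuous g} ->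
  {for x, continuous (fun t => f t + g t)}.
Proof. by move=> ? ?; exact: cvgD. Qed.

Lemma cont_opp f x : {for x, continuous f} -> {for x, continuous (fun t => - f t)}.
Proof. by move=> ?; exact: cvgN. Qed.

Lemma cont_sqr f x : {for x, continuous f} ->
  {for x, continuous (fun t => f t ^+ 2)}.
Proof.
move=> fa; have -> : (fun t => f t ^+ 2) = (fun t => f t * f t) by apply/funext.
exact: cont_mul.
Qed.

Lemma cont_cst (c x : R) : {for x, continuous (fun _ : R => c)}.
Proof. exact: cvg_cst. Qed.

Lemma cont_id x : {for x, continuous (fun t : R => t)}.
Proof. exact: cvg_id. Qed.

Lemma cont_powR f x c : 0 < f x -> {for x, continuous f} ->
  {for x, continuous (fun t => f t `^ c)}.
Proof.
move=> f0 fx; apply: (@continuous_comp _ _ _ f (fun t => t `^ c)) => //.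
by apply: drv_continuous; apply: drv_powR.
Qed.

Lemma cont_expR f x : {for x, continuous f} ->
  {for x, continuous (fun t => expR (f t))}.
Proof.
move=> fx; apply: (@continuous_comp _ _ _ f expR) => //.
exact: continuous_expR.
Qed.

Lemma cont_comp f g x : {for x, continuous f} -> {for (f x), continuous g} ->
  {for x, continuous (fun t => g (f t))}.
Proof. by move=> ? ?; exact: continuous_comp. Qed.

(** The derivative [p c^(p-1)] is at most [p] on []0, 1]] because [p >= 1]; the constant does not
    degenerate as [x] or [y] approaches 0, where a zone ends. *)
Lemma powR_lip (p x y : R) : 1 <= p -> 0 < x <= 1 -> 0 < y <= 1 ->
  `|x `^ p - y `^ p| <= p * `|x - y|.
Proof.
move=> p1; wlog xy : x y / x < y => [H hx hy|].
  have [xy|yx|->] := ltgtP x y; first exact: H.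
    by rewrite distrC (distrC x); exact: H.
  by rewrite !subrr normr0 mulr0.
move=> /andP[x0 x1] /andP[y0 y1].
have D (z : R) : 0 < z -> is_derive z 1 (fun t : R => t `^ p) (p * (z `^ p / z)).
  by move=> z0; eapply drv_eq; [apply: drv_powR; exact: z0|rewrite mulr1].
have [c /andP[xc cy] E] : exists2 c : R, x < c < y &
    y `^ p - x `^ p = p * (c `^ p / c) * (y - x).
  apply: (@MVTc (fun t => t `^ p) (fun z => p * (z `^ p / z)) _ _ xy).
  - by move=> z /andP[xz _]; apply: D; lra.
  - exact: drv_continuous (D x x0).
  - exact: drv_continuous (D y y0).
have c0 : 0 < c by lra.
rewrite distrC (distrC x) E normrM ler_wpM2r // ger0_norm.
  rewrite ler_piMr //; first lra.
  rewrite -powRP1 // -[leRHS](powRr0 c) ger_powR //; lra.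
by rewrite mulr_ge0 ?divr_ge0 ?powR_ge0 //; lra.
Qed.

(** Factor [y^p (1 - y^(P-p))] and use [exp z >= 1 + z] with [z = (P-p) ln y]. This is the cost of
    replacing the subcritical exponent by the critical one, uniform as long as [y] stays above
    [m]. *)
Lemma powR_exponent_lip (m y p P : R) : 0 < m -> m <= y <= 1 -> 0 <= p <= P ->
  `|y `^ p - y `^ P| <= (P - p) * - ln m.
Proof.
move=> m0 /andP[my y1] /andP[p0 pP]; have y0 : 0 < y by lra.
have -> : P = p + (P - p) by ring.
rewrite powRD ?(gt_eqF y0) ?implybT //.
have h0 : 0 <= y `^ p <= 1.
  by rewrite powR_ge0 -[leRHS](powRr0 y) ger_powR // y0.
have h1 : y `^ (P - p) <= 1.
  by rewrite -[leRHS](powRr0 y) ger_powR ?y0 //; lra.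
have lm : ln m <= ln y by rewrite ler_ln.
have h2 : 1 + (P - p) * ln m <= y `^ (P - p).
  rewrite /powR (gt_eqF y0); apply: le_trans (expR_ge1Dx _).
  by rewrite lerD2l ler_wpM2l //; lra.
rewrite ger0_norm; last by nra.
have -> : p + (P - p) - p = P - p by ring.
by nra.
Qed.

End Der.

(** Meant to follow [eapply drv_eq], which leaves the derivative to be found by unification.
    [eassumption] comes first: it supplies the derivatives of unknown functions and the positivity
    conditions of [drv_powR], which must therefore be in the context in exactly the right syntactic
    form. *)
Ltac der := repeat first
  [ eassumption
  | eapply drv_cst | eapply drv_id
  | eapply drv_sqr | eapply drv_inverse
  | eapply drv_powR | eapply drv_expR
  | eapply drv_mul | eapply drv_opp | eapply drv_add ].

(** * The radial equation and its limit profile *)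

Section Ode.
Context {R : realType} (n alpha : R).
Hypotheses (n3 : 3 <= n) (alpha0 : 0 <= alpha).

(* [lra] and [nra] do not see section hypotheses. *)
Local Ltac slra := move: (n3) (alpha0); lra.

Definition pcrit : R := (n + 2 + 2 * alpha) / (n - 2).

(* The absolute value avoids the junk value of [powR] on negative numbers and
   makes the profile differentiable at the origin. *)
Definition Xb (r : R) : R := 1 + `|r| `^ (2 + alpha) / ((n + alpha) * (n - 2)).
Definition Ub (r : R) : R := Xb r `^ (- ((n - 2) / (2 + alpha))).
Definition dUb (r : R) : R :=
  - (`|r| `^ (1 + alpha) / (n + alpha)) * Xb r `^ (- ((n - 2) / (2 + alpha)) - 1).

Lemma pcrit_gt1 : 1 < pcrit.
Proof. by rewrite /pcrit ltr_pdivlMr; slra. Qed.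

Lemma Xb_ge1 r : 1 <= Xb r.
Proof.
rewrite lerDl divr_ge0 ?powR_ge0 // mulr_ge0 //; slra.
Qed.

Lemma Xb_gt0 r : 0 < Xb r.
Proof. exact: lt_le_trans (Xb_ge1 r). Qed.

Lemma Ub_gt0 r : 0 < Ub r.
Proof. by rewrite powR_gt0 // Xb_gt0. Qed.

Lemma gam_gt0 : 0 < (n - 2) / (2 + alpha).
Proof. by rewrite divr_gt0 //; slra. Qed.

Lemma Xb_ler r1 r2 : `|r1| <= `|r2| -> Xb r1 <= Xb r2.
Proof.
move=> r12; have d0 : 0 < (n + alpha) * (n - 2) by rewrite mulr_gt0 //; slra.
rewrite lerD2l ler_pM2r ?invr_gt0 //.
have a0 : 0 <= 2 + alpha by slra.
by apply: (ge0_ler_powR a0) => //; rewrite nnegrE.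
Qed.

Lemma Ub_ler r1 r2 : `|r1| <= `|r2| -> Ub r2 <= Ub r1.
Proof.
move=> /Xb_ler; have := Xb_gt0 r1; have := Xb_gt0 r2.
rewrite /Ub; move: (Xb r1) (Xb r2) (gam_gt0) => X1 X2 g0 X20 X10 X12.
rewrite !powRN lef_pV2 ?posrE ?powR_gt0 //.
by apply: (ge0_ler_powR (ltW g0)) => //; rewrite nnegrE ltW.
Qed.

Lemma Xb0 : Xb 0 = 1.
Proof. by rewrite /Xb normr0 powR0 ?mul0r ?addr0 // gt_eqF //; slra. Qed.

Lemma Ub0 : Ub 0 = 1.
Proof. by rewrite /Ub Xb0 powR1. Qed.

Lemma dUb0 : dUb 0 = 0.
Proof. by rewrite /dUb normr0 powR0 ?mul0r ?oppr0 ?mul0r // gt_eqF //; slra. Qed.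

Lemma Ub_le1 r : Ub r <= 1.
Proof. by rewrite -Ub0 Ub_ler // normr0. Qed.

Lemma near_norm (x : R) : 0 < x -> \forall t \near x, `|t| = t.
Proof.
by move=> x0; apply: filterS (lt_nbhsr x0) => t t0; rewrite gtr0_norm.
Qed.

Lemma Ub_der (r : R) : 0 < r -> is_derive r 1 Ub (dUb r).
Proof.
move=> r0; have X0 := Xb_gt0 r; have rn : `|r| = r by rewrite gtr0_norm.
rewrite /Xb rn in X0.
apply: (@drv_near _ (fun t =>
  (1 + t `^ (2 + alpha) / ((n + alpha) * (n - 2))) `^ (- ((n - 2) / (2 + alpha))))).
  by apply: filterS (near_norm r0) => t tn; rewrite /Ub /Xb tn.
eapply drv_eq; first by der.
rewrite /dUb /Xb rn /= powRP1 //.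
rewrite !powRS2 // powRS1 // in X0 *.
have Z : 0 < (n + alpha) * (n - 2) + r ^+ 2 * r `^ alpha.
  by rewrite addr_gt0 // mulr_gt0 ?exprn_gt0 ?powR_gt0 //; slra.
set w := _ `^ _; field.
by rewrite !gt_eqF //; slra.
Qed.

Lemma dUb_der (r : R) : 0 < r ->
  is_derive r 1 dUb (- ((n - 1) / r * dUb r) - r `^ alpha * Ub r `^ pcrit).
Proof.
move=> r0; have X0 := Xb_gt0 r; have rn : `|r| = r by rewrite gtr0_norm.
rewrite /Ub -powRrM.
(* Criticality enters here: with [g = (n-2)/(2+alpha)] one has [g * pcrit = g + 2], which is the
   power of [Xb] produced by two differentiations. *)
have -> : - ((n - 2) / (2 + alpha)) * pcrit = - ((n - 2) / (2 + alpha)) - 1 - 1.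
  by rewrite /pcrit; field; rewrite !gt_eqF //=; slra.
rewrite (powRP1 (_ - 1)) //.
rewrite /Xb rn in X0.
apply: (@drv_near _ (fun t => - (t `^ (1 + alpha) / (n + alpha)) *
  (1 + t `^ (2 + alpha) / ((n + alpha) * (n - 2))) `^ (- ((n - 2) / (2 + alpha)) - 1))).
  by apply: filterS (near_norm r0) => t tn; rewrite /dUb /Xb tn.
eapply drv_eq; first by der.
rewrite /dUb /Xb rn /=.
rewrite !powRS2 // powRS1 // in X0 *.
have Z : 0 < (n + alpha) * (n - 2) + r ^+ 2 * r `^ alpha.
  by rewrite addr_gt0 // mulr_gt0 ?exprn_gt0 ?powR_gt0 //; slra.
set w := _ `^ (_ - 1); field.
by rewrite !gt_eqF //; slra.
Qed.

Lemma Xb_cont0 : {for 0, continuous Xb}.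
Proof.
apply: cvgD; first exact: cvg_cst.
by apply: cvgMl; apply: cont_normpowR0; slra.
Qed.

Lemma powR_Xb_cont0 c : {for 0, continuous (fun t => Xb t `^ c)}.
Proof.
apply: (@continuous_comp _ _ _ Xb (fun t => t `^ c)); first exact: Xb_cont0.
by apply: drv_continuous; apply: drv_powR; exact: Xb_gt0.
Qed.

Lemma Ub_cont (r : R) : 0 <= r -> {for r, continuous Ub}.
Proof.
rewrite le_eqVlt => /predU1P[<-|r0]; first exact: powR_Xb_cont0.
by apply: drv_continuous; exact: Ub_der.
Qed.

Lemma dUb_cont (r : R) : 0 <= r -> {for r, continuous dUb}.
Proof.
rewrite le_eqVlt => /predU1P[<-|r0].
  apply: cvgM; last exact: powR_Xb_cont0.
  by apply: cvgN; apply: cvgMl; apply: cont_normpowR0; slra.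
by apply: drv_continuous; exact: dUb_der.
Qed.

(** The equation as a first-order system. The odd nonlinearity keeps its meaning through sign
    changes, so that one solution on []0, L[] covers a zone and also what follows its outer zero
    [b]; this is why [hump] carries both [b] and [L]. *)
Definition ode (p L : R) (V dV : R -> R) : Prop :=
  forall r : R, 0 < r < L -> is_derive r 1 V (dV r) /\
    is_derive r 1 dV (- ((n - 1) / r * dV r) - r `^ alpha * (`|V r| `^ (p - 1) * V r)).

(* A nodal zone rescaled by its maximum, attained at [s], up to its outer zero [b];
   [s = 0] in the central zone. *)
Record hump (p L : R) (V dV : R -> R) (s b : R) : Prop := Hump {
  hump_s0 : 0 <= s;
  hump_sb : s < b;
  hump_bL : b <= L;
  hump_ode : ode p L V dV;
  hump_Vs : V s = 1;
  hump_dVs : dV s = 0;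
  hump_V01 : forall r, s <= r < b -> 0 < V r <= 1;
  hump_Vb : V b = 0;
  hump_Vsc : {for s, continuous V};
  hump_dVsc : {for s, continuous dV};
  hump_Vbc : {for b, continuous V} }.

End Ode.

(** * Convergence of a rescaled zone to the limit profile *)

Section Conv.
Context {R : realType} (n alpha : R).
Hypotheses (n3 : 3 <= n) (alpha0 : 0 <= alpha).
Local Ltac slra := move: (n3) (alpha0); lra.
Local Notation pcrit := (pcrit n alpha).
Local Notation Ub := (Ub n alpha).
Local Notation dUb := (dUb n alpha).
Local Notation hump := (hump n alpha).

Lemma hump_cont p L V dV s b : hump p L V dV s b -> forall r, s <= r < b ->
  {for r, continuous V} /\ {for r, continuous dV}.
Proof.
move=> B r /andP[]; rewrite le_eqVlt => /predU1P[<- _|sr rb].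
  by split; [exact: hump_Vsc B|exact: hump_dVsc B].
have rL : 0 < r < L by have := hump_s0 B; have := hump_bL B; lra.
have [V1 V2] := hump_ode B rL.
by split; [exact: drv_continuous V1|exact: drv_continuous V2].
Qed.

Lemma hump_der p L V dV s b (t : R) : hump p L V dV s b -> 1 < p -> s < t < b ->
  [/\ 0 < t, is_derive t 1 V (dV t),
    is_derive t 1 dV (- ((n - 1) / t * dV t) - t `^ alpha * V t `^ p) &
    0 < V t <= 1].
Proof.
move=> B p1 /andP[st tb]; have tsb : s <= t < b by lra.
have s0 := hump_s0 B; have bL := hump_bL B.
have tL : 0 < t < L by lra.
have [V1 V2] := hump_ode B tL; have V01 := hump_V01 B tsb; split => //.
  by case/andP: tL.
have /andP[Vt0 _] := V01; move: V2.
by rewrite gtr0_norm // (mulrC (_ `^ (p - 1))) mulr_powRB1 ?(ltW Vt0) //; lra.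
Qed.

(* The term [(n-1)/t] enters the derivative of [F] with a good sign, so that
   the singularity at the origin is harmless. *)
Lemma gronwall (p q B A eta s r : R) (V dV W dW : R -> R) :
  1 < p <= B -> 0 <= s <= r ->
  (forall t, s < t < r -> [/\ is_derive t 1 V (dV t),
    is_derive t 1 dV (- ((n - 1) / t * dV t) - t `^ alpha * V t `^ p) &
    0 < V t <= 1]) ->
  (forall t, s < t < r -> [/\ is_derive t 1 W (dW t),
    is_derive t 1 dW (- ((n - 1) / t * dW t) - t `^ alpha * W t `^ q),
    0 < W t <= 1 & `|W t `^ p - W t `^ q| <= eta]) ->
  (forall t, s < t < r -> t `^ alpha <= A) -> 0 <= A ->
  {for s, continuous V} -> {for s, continuous dV} ->
  {for s, continuous W} -> {for s, continuous dW} ->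
  {for r, continuous V} -> {for r, continuous dV} ->
  {for r, continuous W} -> {for r, continuous dW} ->
  (V r - W r) ^+ 2 + (dV r - dW r) ^+ 2 + eta ^+ 2 <=
  ((V s - W s) ^+ 2 + (dV s - dW s) ^+ 2 + eta ^+ 2) *
    expR ((1 + A * B + A) * (r - s)).
Proof.
move=> /andP[p1 pB] /andP[s0 sr] HV HW HA A0 cV cdV cW cdW cV' cdV' cW' cdW'.
set C := 1 + A * B + A.
(* Including [eta^2] absorbs the error due to the change of exponent, so that the differential
   inequality is the homogeneous [F' <= C F] and [g] below is nonincreasing. *)
pose F t := (V t - W t) ^+ 2 + (dV t - dW t) ^+ 2 + eta ^+ 2.
rewrite -!/(F _).
pose d t := V t - W t; pose e t := dV t - dW t.
pose dF t := 2 * d t * e t + 2 * e t * (- ((n - 1) / t * e t) -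
   t `^ alpha * (V t `^ p - W t `^ q)).
pose g t := F t * expR (- (C * (t - s))).
have cg x : {for x, continuous V} -> {for x, continuous dV} ->
    {for x, continuous W} -> {for x, continuous dW} -> {for x, continuous g}.
  move=> cVx cdVx cWx cdWx; apply: cont_mul.
    apply: cont_add; last exact: cont_cst.
    apply: cont_add; apply: cont_sqr.
      by apply: cont_add => //; exact: cont_opp.
    by apply: cont_add => //; exact: cont_opp.
  apply: cont_expR; apply: cont_opp; apply: cont_mul; first exact: cont_cst.
  by apply: cont_add; [exact: cont_id|exact: cont_cst].
have : g r <= g s.
  apply: (@drv_nincr _ g (fun t => (dF t - C * F t) * expR (- (C * (t - s))))) => //.
  - move=> t str; have [V1 V2 _] := HV t str; have [W1 W2 _ _] := HW t str.
    rewrite /g /F; eapply drv_eq; first by der.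
    rewrite /dF /d /e /F /=; ring.
  - move=> t str; apply: mulr_le0_ge0; last exact: expR_ge0.
    have t0 : 0 < t by move: str; lra.
    have [_ _ V01] := HV t str; have [_ _ W01 H0] := HW t str.
    have H1 : `|V t `^ p - W t `^ q| <= p * `|d t| + eta.
      rewrite -(subrK (W t `^ p) (V t `^ p)) -addrA.
      apply: le_trans (ler_normD _ _) _; apply: lerD => //.
      by apply: powR_lip => //; exact: ltW.
    have H2 := powR_ge0 t alpha; have H2' := HA t str.
    have H3 : 0 <= (n - 1) / t * e t ^+ 2.
      by rewrite mulr_ge0 ?sqr_ge0 // divr_ge0 ?(ltW t0) //; slra.
    have dF_E : dF t = 2 * d t * e t - 2 * ((n - 1) / t * e t ^+ 2)
       - (2 * e t * t `^ alpha * (V t `^ p - W t `^ q)) by rewrite /dF; ring.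
    rewrite dF_E (_ : F t = d t ^+ 2 + e t ^+ 2 + eta ^+ 2) // /C.
    move: (V t `^ p - W t `^ q) (d t) (e t) (t `^ alpha) H1 H2 H2' H3
      => X D E T H1 H2 H2'; move: (_ / t * _) => Z H3.
    have H4 : - (2 * E * T * X) <= 2 * `|E| * (A * (p * `|D| + eta)).
      apply: le_trans (ler_norm _) _.
      rewrite normrN !normrM (ger0_norm (_ : 0 <= 2)) // -mulrA ler_wpM2l ?mulr_ge0 //.
      by rewrite ler_pM // ger0_norm.
    have H5 : 2 * `|E| * (A * (p * `|D| + eta)) <=
        A * (B * (D ^+ 2 + E ^+ 2) + E ^+ 2 + eta ^+ 2).
      rewrite mulrCA ler_wpM2l //.
      rewrite -(real_normK (num_real D)) -(real_normK (num_real E)).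
      move: (normr_ge0 D) (normr_ge0 E); move: `|D| `|E| => D' E' D0 E0.
      have Q1 : 0 <= p * (D' - E') ^+ 2 by rewrite mulr_ge0 ?sqr_ge0 //; lra.
      have Q2 : 0 <= (eta - E') ^+ 2 := sqr_ge0 _.
      have Q3 : p * (D' ^+ 2 + E' ^+ 2) <= B * (D' ^+ 2 + E' ^+ 2).
        by rewrite ler_wpM2r ?addr_ge0 ?sqr_ge0.
      by lra.
    have Q1 : 0 <= (D - E) ^+ 2 := sqr_ge0 _.
    have Q2 : 0 <= A * D ^+ 2 by rewrite mulr_ge0 ?sqr_ge0.
    have Q3 : 0 <= A * (B * eta ^+ 2) by rewrite mulr_ge0 // mulr_ge0 ?sqr_ge0 //; lra.
    have Q4 := sqr_ge0 eta.
    by lra.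
  - exact: cg.
  - exact: cg.
rewrite /g subrr mulr0 oppr0 expR0 mulr1 expRN.
by rewrite ler_pdivrMr ?expR_gt0.
Qed.

(** Gronwall is started at [s], where [V] and [dV] take the values 1 and 0 of the limit profile and
    its derivative at the origin; continuity of the latter pays for [s > 0]. The change of exponent
    is controlled because the limit profile is at least its value at [rad] on the whole interval.
    The threshold [d] depends on neither the zone nor its end [b], as the induction requires. *)
Lemma hump_conv (rad eps : R) : 0 < rad -> 0 < eps ->
  exists2 d, 0 < d & forall p L V dV s b, 1 < p -> pcrit - d < p < pcrit ->
  s < d -> hump p L V dV s b ->
  rad < b /\ forall r, s <= r <= rad ->
    `|V r - Ub r| < eps /\ `|dV r - dUb r| < eps.
Proof.
move=> rad0 eps0.
have P1 := pcrit_gt1 n3 alpha0.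
move: (Ub_der n3 alpha0) (dUb_der n3 alpha0) (Ub_cont n3 alpha0) (dUb_cont n3 alpha0).
move: (Ub_gt0 n3 alpha0) (Ub_le1 n3 alpha0) (Ub_ler n3 alpha0) (Ub0 n3 alpha0) (dUb0 n3 alpha0).
(* Abstracting [Ub] keeps [lra] from unfolding it. *)
move: Ub dUb => U dU U_gt0 U_le1 U_ler U0 dU0 U_der dU_der U_cont dU_cont.
move: pcrit P1 dU_der => P P1 dU_der.
pose C := 1 + rad `^ alpha * P + rad `^ alpha.
have C0 : 0 <= C.
  have A0 := powR_ge0 rad alpha.
  have : 0 <= rad `^ alpha * P by rewrite mulr_ge0 //; lra.
  by rewrite /C; lra.
have Ur0 := U_gt0 rad; have Ur1 := U_le1 rad.
(* The second bound keeps [V] away from 0 up to [rad], which will exclude [b <= rad]. *)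
pose e0 := Num.min eps (U rad / 2).
have e00 : 0 < e0 by rewrite lt_min eps0 divr_gt0.
have e0e : e0 <= eps by rewrite ge_min lexx.
have e02 : e0 <= U rad / 2 by rewrite ge_min lexx orbT.
clearbody e0.
pose E := expR (C * rad); have E0 : 0 < E by exact: expR_gt0.
have EC t : t <= rad -> expR (C * t) <= E.
  by move=> trad; rewrite ler_expR ler_wpM2l.
clearbody E.
(* Three initial errors, each below [k <= 1], have squares below [k]; the factor 3 makes their sum,
   amplified by the Gronwall factor [E], less than [e0^2]. *)
pose k := Num.min 1 (e0 ^+ 2 / (3 * E)).
have k0 : 0 < k by rewrite lt_min ltr01 divr_gt0 ?exprn_gt0 // mulr_gt0.
have k1 : k <= 1 by rewrite ge_min lexx.
have kE : k <= e0 ^+ 2 / (3 * E) by rewrite ge_min lexx orbT.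
clearbody k.
have /cont_epsP/(_ k k0)[d1 d10 H1] := U_cont 0 (lexx 0).
have /cont_epsP/(_ k k0)[d2 d20 H2] := dU_cont 0 (lexx 0).
have lnm0 : 0 <= - ln (U rad) by rewrite oppr_ge0 ln_le0.
set lnm := - ln _ in lnm0.
(* Makes [eta = (P - p) * lnm] less than [k]; the [+ 1] covers [lnm = 0]. *)
pose d3 := k / (lnm + 1); have d30 : 0 < d3 by rewrite divr_gt0 //; lra.
exists (Num.min d1 (Num.min d2 d3)); first by rewrite !lt_min d10 d20.
move=> p L V dV s b p1 /andP[pd pP]; rewrite !lt_min => /and3P[sd1 sd2 sd3] B.
have [s0 sb] := (hump_s0 B, hump_sb B).
have pd3 : P - p < d3.
  have : Num.min d1 (Num.min d2 d3) <= d3 by rewrite !ge_min lexx !orbT.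
  by lra.
have key r : s <= r < b -> r <= rad ->
    `|V r - U r| < e0 /\ `|dV r - dU r| < e0.
  move=> srb rrad.
  have pp : 1 < p < P by rewrite p1.
  have /andP[sr rb] := srb.
  have [Vs dVs] := hump_cont B (r := s) ltac:(lra).
  have [Vr dVr] := hump_cont B srb.
  have r0 : 0 <= r by lra.
  have HV t : s < t < r -> [/\ is_derive t 1 V (dV t),
    is_derive t 1 dV (- ((n - 1) / t * dV t) - t `^ alpha * V t `^ p) &
    0 < V t <= 1].
    move=> /andP[st tr]; have tsb : s < t < b by lra.
    by have [] := hump_der B p1 tsb.
  have HW t : s < t < r -> [/\ is_derive t 1 U (dU t),
    is_derive t 1 dU (- ((n - 1) / t * dU t) - t `^ alpha * U t `^ P),
    0 < U t <= 1 & `|U t `^ p - U t `^ P| <= (P - p) * - ln (U rad)].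
    move=> /andP[st tr]; have t0 : 0 < t by lra.
    split; [exact: U_der|exact: dU_der|by rewrite U_gt0 U_le1|].
    apply: powR_exponent_lip; rewrite ?U_gt0 ?U_le1 ?andbT //; last by lra.
    by apply: U_ler; rewrite !gtr0_norm //; lra.
  have HA t : s < t < r -> t `^ alpha <= rad `^ alpha.
    move=> /andP[st tr]; have t0 : 0 <= t := le_trans s0 (ltW st).
    have trad : t <= rad := le_trans (ltW tr) rrad.
    exact: (ge0_ler_powR alpha0 t0 (ltW rad0) trad).
  have := @gronwall p P P (rad `^ alpha) ((P - p) * - ln (U rad)) s r V dV U dU.
  rewrite p1 (ltW pP) s0 sr.
  move=> /(_ isT isT) G0; have {G0}G := G0 HV HW HA (powR_ge0 _ _) Vs dVs
    (U_cont s s0) (dU_cont s s0) Vr dVr (U_cont r r0) (dU_cont r r0).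
  move: G.
  rewrite -/C -/lnm (hump_Vs B) (hump_dVs B) sub0r.
  set eta := (P - p) * lnm => G.
  have eta0 : 0 <= eta by rewrite mulr_ge0 //; lra.
  have etak : eta < k.
    move: pd3; rewrite /d3 ltr_pdivlMr; last by lra.
    by rewrite /eta; nra.
  have := H1 s; rewrite subr0 ger0_norm // U0 => /(_ sd1); rewrite distrC => U1.
  have := H2 s; rewrite subr0 ger0_norm // dU0 subr0 => /(_ sd2) U2.
  have kk : k ^+ 2 <= k by rewrite expr2 ler_piMr // ltW.
  have sq x : `|x| < k -> x ^+ 2 < k.
    move=> xk; apply: lt_le_trans kk; rewrite -(real_normK (num_real x)).
    by rewrite ltr_pXn2r // nnegrE // ltW.
  have F3 : (1 - U s) ^+ 2 + (- dU s) ^+ 2 + eta ^+ 2 < e0 ^+ 2 / E.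
    have -> : e0 ^+ 2 / E = 3 * (e0 ^+ 2 / (3 * E)) by field; rewrite gt_eqF.
    have := sq _ U1; have := sq (- dU s); rewrite normrN => /(_ U2).
    have := sq eta; rewrite ger0_norm // => /(_ etak).
    by move: kE; lra.
  have G2 : (V r - U r) ^+ 2 + (dV r - dU r) ^+ 2 + eta ^+ 2 < e0 ^+ 2.
    apply: le_lt_trans G _.
    rewrite -[ltRHS](divfK (lt0r_neq0 E0)).
    apply: (@le_lt_trans _ _ (((1 - U s) ^+ 2 + (- dU s) ^+ 2 + eta ^+ 2) * E)).
      by rewrite ler_wpM2l ?addr_ge0 ?sqr_ge0 // EC // lerBlDr ler_wpDr.
    by rewrite ltr_pM2r.
  have nl (x : R) : x ^+ 2 < e0 ^+ 2 -> `|x| < e0.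
    rewrite -(real_normK (num_real x)) => H.
    by rewrite -(@ltr_pXn2r _ 2) // nnegrE // ltW.
  have := sqr_ge0 (V r - U r); have := sqr_ge0 (dV r - dU r); have := sqr_ge0 eta.
  move: (V r - U r) (dV r - dU r) G2 => X Y G2 P1' P2' P3'.
  by split; apply: nl; clear -G2 P1' P2' P3'; lra.
(* If [b <= rad], then just before [b] continuity gives [V < U rad / 2], while [key] and the
   monotonicity of [U] give [V > U rad / 2]. *)
have radb : rad < b.
  rewrite ltNge; apply/negP => brad.
  have e20 : 0 < U rad / 2 by rewrite divr_gt0.
  have /cont_epsP/(_ _ e20)[d d0 H] := hump_Vbc B.
  pose y := Num.max s (b - d / 2).
  have sy : s <= y by rewrite le_max lexx.
  have yb : y < b by rewrite gt_max sb /=; lra.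
  have dy : b - d / 2 <= y by rewrite le_max lexx orbT.
  have /H : `|y - b| < d by rewrite distrC ger0_norm; lra.
  have syb : s <= y < b by rewrite sy.
  have yrad : y <= rad by lra.
  rewrite (hump_Vb B) subr0; have [K _] := key y syb yrad.
  have Uy : U rad <= U y by apply: U_ler => //; rewrite !ger0_norm //; lra.
  move: K; rewrite !ltr_norml; lra.
split=> // r /andP[sr rrad].
have srb : s <= r < b by lra.
have [K1 K2] := key r srb rrad.
by split; [exact: lt_le_trans K1 _|exact: lt_le_trans K2 _].
Qed.
End Conv.

(** * Decay of a zone and flux through its outer zero *)

Section Flux.
Context {R : realType} (n alpha : R).
Hypotheses (n3 : 3 <= n) (alpha0 : 0 <= alpha).
Local Ltac slra := move: (n3) (alpha0); lra.
Local Notation pcrit := (pcrit n alpha).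
Local Notation ode := (ode n alpha).
Local Notation hump := (hump n alpha).

Lemma cont_normpowR (a s : R) : 1 <= a -> 0 <= s ->
  {for s, continuous (fun t : R => `|t| `^ a)}.
Proof.
move=> a1; rewrite le_eqVlt => /predU1P[<-|s0]; first exact: cont_normpowR0.
apply: drv_continuous; apply: (@drv_near _ (fun t => t `^ a)).
  by apply: filterS (near_norm s0) => t ->.
by apply: drv_powR.
Qed.

(* As in [Xb], the absolute value ensures continuity at the origin. *)
Definition flux (dV : R -> R) (t : R) := - (`|t| `^ (n - 1) * dV t).

Lemma flux_der p L V dV (t : R) : ode p L V dV -> 0 < t < L ->
  is_derive t 1 (flux dV)
    (t `^ (n - 1) * t `^ alpha * (`|V t| `^ (p - 1) * V t)).
Proof.
move=> O tL; have [V1 V2] := O t tL; have /andP[t0 _] := tL.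
apply: (@drv_near _ (fun t => - (t `^ (n - 1) * dV t))).
  by apply: filterS (near_norm t0) => z zz; rewrite /flux zz.
eapply drv_eq; first by der.
rewrite /=; field; exact: lt0r_neq0.
Qed.

Lemma hump_fluxd p L V dV s b (t : R) : hump p L V dV s b -> 1 < p -> s < t < b ->
  is_derive t 1 (flux dV) (t `^ (n - 1) * t `^ alpha * V t `^ p).
Proof.
move=> B p1 tsb; have [t0 _ _ /andP[Vt0 _]] := hump_der B p1 tsb.
have bL := hump_bL B.
have tL : 0 < t < L by lra.
have := flux_der (hump_ode B) tL.
by rewrite gtr0_norm // (mulrC (_ `^ (p - 1))) mulr_powRB1 ?(ltW Vt0) //; lra.
Qed.

Lemma hump_flux_cont p L V dV s b (t : R) : hump p L V dV s b -> s <= t < b ->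
  {for t, continuous (flux dV)}.
Proof.
move=> B tsb; have [_ dVc] := hump_cont B tsb; have s0 := hump_s0 B.
apply: cont_opp; apply: cont_mul => //; apply: cont_normpowR; last by lra.
slra.
Qed.

Lemma hump_flux_gt0 p L V dV s b (t : R) : hump p L V dV s b -> 1 < p ->
  s < t < b -> 0 < flux dV t.
Proof.
move=> B p1 tsb; have /andP[st tb] := tsb.
have [c sct] : exists2 c, s < c < t & flux dV t - flux dV s =
    c `^ (n - 1) * c `^ alpha * V c `^ p * (t - s).
  apply: (@MVTc _ (flux dV) (fun t => t `^ (n - 1) * t `^ alpha * V t `^ p) s t st).
  - by move=> x sxt; apply: (hump_fluxd B p1); lra.
  - by apply: (hump_flux_cont B); rewrite lexx (lt_trans st).
  - by apply: (hump_flux_cont B); rewrite ltW.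
rewrite [X in _ - X]/flux (hump_dVs B) mulr0 oppr0 subr0 => ->.
have cs : s < c < b by lra.
have [c0 _ _ /andP[Vc0 _]] := hump_der B p1 cs.
by rewrite !mulr_gt0 ?powR_gt0 // subr_gt0.
Qed.

Lemma hump_dV_lt0 p L V dV s b (t : R) : hump p L V dV s b -> 1 < p ->
  s < t < b -> dV t < 0.
Proof.
move=> B p1 tsb; have := hump_flux_gt0 B p1 tsb.
have [t0 _ _ _] := hump_der B p1 tsb.
by rewrite /flux oppr_gt0 pmulr_rlt0 // powR_gt0 // normr_gt0 lt0r_neq0.
Qed.

(* With [pcrit + 1] instead of [p + 1] in the denominator, the derivative only
   involves [V^p V'] and has a sign. *)
Definition pohozaev p (V dV : R -> R) (t : R) :=
  `|t| `^ n * (dV t ^+ 2) / 2 + (n - 2) / 2 * `|t| `^ (n - 1) * (V t * dV t) +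
  `|t| `^ (n + alpha) * V t `^ (p + 1) / (pcrit + 1).

(** At [s] only the last, nonnegative term survives. Since [(n+alpha)/(pcrit+1) = (n-2)/2], the
    terms in [V^(p+1)] cancel in the derivative, which reduces to [t^(n+alpha) V^p (- V')] times
    [1 - (p+1)/(pcrit+1)]; this is nonnegative because [V] decreases and [p <= pcrit]. *)
Lemma pohozaev_ge0 p L V dV s b (t : R) : hump p L V dV s b -> 1 < p <= pcrit ->
  s <= t < b -> 0 <= pohozaev p V dV t.
Proof.
move=> B /andP[p1 pP] /andP[st tb]; have s0 := hump_s0 B.
have P0 : 0 < pcrit + 1 by lra.
apply: (@le_trans _ _ (pohozaev p V dV s)).
  rewrite /pohozaev (hump_dVs B) !(expr0n, mulr0, mul0r, add0r) /=.
  by rewrite divr_ge0 ?mulr_ge0 ?powR_ge0 // ltW.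
have pc x : s <= x < b -> {for x, continuous (pohozaev p V dV)}.
  move=> sxb; have [? ?] := hump_cont B sxb.
  have /andP[? _] := hump_V01 B sxb.
  have x0 : 0 <= x by lra.
  have ? : {for x, continuous (fun t : R => `|t| `^ n)}.
    by apply: cont_normpowR => //; slra.
  have ? : {for x, continuous (fun t : R => `|t| `^ (n - 1))}.
    by apply: cont_normpowR => //; slra.
  have ? : {for x, continuous (fun t : R => `|t| `^ (n + alpha))}.
    by apply: cont_normpowR => //; slra.
  apply: cont_add; first apply: cont_add.
  - apply: cont_mul; last exact: cont_cst.
    by apply: cont_mul => //; exact: cont_sqr.
  - apply: cont_mul; last exact: cont_mul.
    by apply: cont_mul => //; exact: cont_cst.
  - apply: cont_mul; last exact: cont_cst.
    by apply: cont_mul => //; exact: cont_powR.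
apply: (@drv_ndecr _ (pohozaev p V dV) (fun t =>
  t `^ n * t `^ alpha * (V t `^ p * - dV t) * (1 - (p + 1) / (pcrit + 1)))) => //.
- move=> x sxt; have sxb : s < x < b by lra.
  have [x0 V1 V2 /andP[Vx0 _]] := hump_der B p1 sxb.
  apply: (@drv_near _ (fun t => t `^ n * (dV t ^+ 2) / 2 +
    (n - 2) / 2 * t `^ (n - 1) * (V t * dV t) +
    t `^ (n + alpha) * V t `^ (p + 1) / (pcrit + 1))).
    by apply: filterS (near_norm x0) => z zz; rewrite /pohozaev zz.
  eapply drv_eq; first by der.
  have xn0 := lt0r_neq0 x0.
  rewrite /= powRP1 // (powRD (r := n)) ?xn0 ?implybT // (addrC p) powRS1 //.
  rewrite /pcrit; field.
  by rewrite xn0 !lt0r_neq0 //; slra.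
- move=> x sxt; have sxb : s < x < b by lra.
  have [x0 V1 V2 /andP[Vx0 _]] := hump_der B p1 sxb.
  have dV0 := hump_dV_lt0 B p1 sxb.
  rewrite !mulr_ge0 ?powR_ge0 // ?oppr_ge0 ?(ltW dV0) // subr_ge0 ler_pdivrMr //; lra.
- by apply: pc; rewrite lexx (le_lt_trans st).
- by apply: pc; rewrite st.
Qed.
(* This quantity is constant for the limit profile. *)
Definition aplevel (V dV : R -> R) (t : R) :=
  - dV t * t `^ (- (1 + alpha)) * (V t `^ (- ((2 + alpha) / (n - 2))) / V t).

(** The derivative is a positive multiple of [pohozaev]. As [aplevel] is [n - 2] times the
    derivative of [V^(-(2+alpha)/(n-2))] with respect to [t^(2+alpha)], this is the convexity from
    which the decay is read off. *)
Lemma aplevel_ndecr p L V dV s b (t u : R) : hump p L V dV s b ->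
  1 < p <= pcrit -> s < t -> t <= u -> u < b -> aplevel V dV t <= aplevel V dV u.
Proof.
move=> B pP st tu ub; have /andP[p1 _] := pP.
set g := (2 + alpha) / (n - 2).
have D x : t <= x <= u -> is_derive x 1 (aplevel V dV)
    (2 * (g + 1) * pohozaev p V dV x * (x `^ (- (1 + alpha)) / x `^ n) *
     (V x `^ (- g) / V x / V x)).
  move=> txu; have sxb : s < x < b by lra.
  have [x0 V1 V2 /andP[Vx0 _]] := hump_der B p1 sxb.
  have xn0 := lt0r_neq0 x0; have Vn0 := lt0r_neq0 Vx0.
  have xp0 := lt0r_neq0 (powR_gt0 n x0).
  rewrite /aplevel -/g; eapply drv_eq; first by der.
  rewrite /pohozaev /= gtr0_norm // powRP1 // (powRD (r := n)) ?xn0 ?implybT //.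
  rewrite (addrC p) powRS1 // /pcrit /g; field.
  by rewrite xn0 Vn0 xp0 !lt0r_neq0 //; slra.
apply: (drv_ndecr tu _ _ _ _) => [x /andP[tx xu]|x /andP[tx xu]||].
- by apply: D; rewrite !ltW.
- have sxb : s <= x < b by lra.
  have x0 : 0 < x by have := hump_s0 B; lra.
  have /andP[Vx0 _] := hump_V01 B sxb.
  have g0 : 0 < g by rewrite divr_gt0 //; slra.
  apply: mulr_ge0; last by rewrite !divr_ge0 ?powR_ge0 // ltW.
  apply: mulr_ge0; last by rewrite divr_ge0 ?powR_ge0.
  by apply: mulr_ge0; [lra|exact: (pohozaev_ge0 B pP)].
- by apply: drv_continuous (D t _); rewrite lexx tu.
- by apply: drv_continuous (D u _); rewrite lexx tu.
Qed.

(** Equivalent to [V <= C t^(2-n)]. In the variable [t^(2+alpha)] the left side is a line of slope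
    [c], while the right side is at least [1 >= c] at [t = 1], and its slope there is at least
    [- dV 1 / (n-2) >= c] (since [V 1 <= 1]) and increases afterwards. *)
Lemma hump_decay p L V dV s b (c t : R) : hump p L V dV s b -> 1 < p <= pcrit ->
  s < 1 < b -> 0 < c <= 1 -> c <= - dV 1 / (n - 2) -> 1 <= t < b ->
  c * t `^ (2 + alpha) <= V t `^ (- ((2 + alpha) / (n - 2))).
Proof.
move=> B pP s1b /andP[c0 c1] cd /andP[t1 tb]; have /andP[p1 _] := pP.
set g := (2 + alpha) / (n - 2).
have g0 : 0 < g by rewrite divr_gt0 //; slra.
pose h t := V t `^ (- g) - c * t `^ (2 + alpha).
have D x : 1 <= x < b -> is_derive x 1 h
    (g * (aplevel V dV x - c * (n - 2)) * x `^ (1 + alpha)).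
  move=> xb; have sxb : s < x < b by lra.
  have [x0 V1 V2 /andP[Vx0 _]] := hump_der B p1 sxb.
  have xn0 := lt0r_neq0 x0; have Vn0 := lt0r_neq0 Vx0.
  have xp0 := lt0r_neq0 (powR_gt0 alpha x0).
  rewrite /h /aplevel -/g; eapply drv_eq; first by der.
  rewrite /= (powRN x) powRS2 // powRS1 //.
  move: (V x `^ (- g)) => Y.
  rewrite /g; field.
  by rewrite xn0 Vn0 xp0 !lt0r_neq0 //; slra.
have V1 : 1 <= V 1 `^ (- g).
  have s1b' : s <= 1 < b by lra.
  have /andP[V10 V11] := hump_V01 B s1b'.
  by rewrite -[leLHS](powRr0 (V 1)) ger_powR ?V10 // oppr_le0 ltW.
have : h 1 <= h t.
  apply: (@drv_ndecr _ h _ _ _ t1) => [x xt|x xt||].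
  - by apply: D; lra.
  - apply: mulr_ge0; last exact: powR_ge0.
    rewrite pmulr_rge0 // subr_ge0.
    have s1b' : s < 1 by lra.
    have x1 : 1 <= x by lra.
    have xb : x < b by lra.
    apply: le_trans (aplevel_ndecr B pP s1b' x1 xb).
    have s1b'' : s <= 1 < b by lra.
    have /andP[V10 V11] := hump_V01 B s1b''.
    rewrite /aplevel powR1 mulr1 -/g.
    apply: (@le_trans _ _ (- dV 1)).
      by rewrite -ler_pdivlMr //; slra.
    rewrite ler_peMr //; last first.
      by rewrite ler_pdivlMr // mul1r (le_trans V11).
    have s1b2 : s < 1 < b by lra.
    by have := hump_dV_lt0 B p1 s1b2; lra.
  - by apply: drv_continuous (D 1 _); lra.
  - by apply: drv_continuous (D t _); lra.
rewrite /h powR1 mulr1.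
by move: (c * _) (V t `^ _) => X Y; lra.
Qed.

(** The decay bounds the source [t^(n-1+alpha) V^p] by [D / t^2] beyond [t = 1], which is integrable
    up to infinity, so the flux gains at most [D] between 1 and [b], wherever [b] lies. At 1 it
    equals [- dV 1], known by convergence. The condition [b < L] makes the equation available at
    [b]. *)
Lemma hump_flux_bound : exists d K : R, [/\ 0 < d, 1 <= K &
  forall p L V dV s b, 1 < p -> pcrit - d < p < pcrit -> s < d ->
  hump p L V dV s b -> b < L -> [/\ 1 < b, 0 < flux dV b & flux dV b <= K]].
Proof.
have X1 : 0 < - dUb n alpha 1.
  rewrite /dUb normr1 powR1 mulNr opprK mulr_gt0 ?powR_gt0 ?Xb_gt0 //.
  by rewrite divr_gt0 //; slra.
move: (hump_conv n3 alpha0) X1; move: (Ub n alpha) (dUb n alpha) => U dU HC m0.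
set m := - dU 1 in m0.
have m20 : 0 < m / 2 by rewrite divr_gt0.
have [d d0 {}HC] := HC 1 (m / 2) ltr01 m20.
have n20 : 0 < n - 2 by slra.
pose c := Num.min 1 (m / 2 / (n - 2)).
have c0 : 0 < c by rewrite lt_min ltr01 divr_gt0.
have c1 : c <= 1 by rewrite ge_min lexx.
have c2 : c <= m / 2 / (n - 2) by rewrite ge_min lexx orbT.
clearbody c.
set g := (2 + alpha) / (n - 2).
have g0 : 0 < g by rewrite divr_gt0 //; slra.
(* With [pcrit] in the exponent, [D] does not depend on [p]; since [c <= 1], it dominates the
   constant [c^(-p/g)] that the decay provides. *)
pose D := c `^ (- (pcrit / g)).
have D0 : 0 < D by exact: powR_gt0.
(* The three bounds serve the convergence at 1, the inequality [s < 1], and the exponent estimate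
   [pn]. In [K], [2 * m] exceeds [- dV 1], which lies within [m / 2] of [m]. *)
exists (Num.min (Num.min d 1) (n - 2)^-1), (1 + 2 * m + D); split.
- by rewrite !lt_min d0 ltr01 invr_gt0.
- lra.
move=> p L V dV s b p1 /andP[pd pP]; rewrite !lt_min => /andP[/andP[sd s1] _] B bL.
have pd1 : pcrit - d < p.
  by apply: le_lt_trans pd; rewrite lerD2l lerN2 !ge_min lexx.
have pd2 : pcrit - (n - 2)^-1 < p.
  by apply: le_lt_trans pd; rewrite lerD2l lerN2 !ge_min lexx orbT.
have [|b1 H1] := HC p L V dV s b p1 _ sd B; first by rewrite pd1.
have s0 := hump_s0 B.
have [|_] := H1 1; first by rewrite lexx ltW.
rewrite ltr_norml /m => /andP[d1 d2].
have pPw : 1 < p <= pcrit by rewrite p1 ltW.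
have dV1 : c <= - dV 1 / (n - 2).
  apply: le_trans c2 _; rewrite ler_pM2r ?invr_gt0 // /m; lra.
have fluxc : {for b, continuous (flux dV)}.
  have b0L : 0 < b < L by lra.
  exact: drv_continuous (flux_der (hump_ode B) b0L).
(* Since [(n-2) * pcrit = n + 2 + 2 * alpha] and at most 1 is lost, the power
   [n - 1 + alpha - (n-2) p] left in the source is at most -2. *)
have pn : (n - 2) * p >= n + 1 + alpha.
  have : (n - 2) * (pcrit - p) <= 1.
    rewrite -ler_pdivlMl // mulr1; lra.
  rewrite mulrBr /pcrit mulrCA divff ?lt0r_neq0 // mulr1; slra.
have cinv (x : R) : 0 < x -> {for x, continuous (fun t : R => t^-1)}.
  by move=> x0; apply: inv_continuous; rewrite gt_eqF.
have fb t : 1 < t < b -> is_derive t 1 (fun t => flux dV t + D / t)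
   (t `^ (n - 1) * t `^ alpha * V t `^ p - D / t ^+ 2).
  move=> /andP[t1 tb]; have stb : s < t < b by lra.
  have tn0 : t != 0 by rewrite gt_eqF //; lra.
  have ? := hump_fluxd B p1 stb.
  eapply drv_eq; first by der.
  by rewrite /=; ring.
have H : flux dV b + D / b <= flux dV 1 + D / 1.
  apply: (drv_nincr (ltW b1) fb).
  - move=> t /andP[t1 tb]; rewrite subr_le0.
    have t0 : 0 < t by lra.
    have t1b : 1 <= t < b by lra.
    have s1b : s < 1 < b by lra.
    have c01 : 0 < c <= 1 by rewrite c0.
    have := hump_decay B pPw s1b c01 dV1 t1b.
    have stb : s < t < b by lra.
    have [_ _ _ /andP[Vt0 _]] := hump_der B p1 stb.
    rewrite -/g => H.
    have pg0 : 0 <= p / g by rewrite divr_ge0 ?ltW //; lra.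
    have {H} : c `^ (p / g) * t `^ ((n - 2) * p) <= (V t `^ p)^-1.
      have -> : (V t `^ p)^-1 = (V t `^ (- g)) `^ (p / g).
        by rewrite -powRrM -powRN mulNr mulrCA divff ?mulr1 ?lt0r_neq0.
      have -> : (n - 2) * p = (2 + alpha) * (p / g).
        by rewrite /g; field; rewrite !lt0r_neq0 //; slra.
      rewrite (powRrM t) -powRM ?powR_ge0 ?(ltW c0) //.
      by apply: (ge0_ler_powR pg0) => //; rewrite nnegrE ?powR_ge0 // mulr_ge0 ?powR_ge0 // ltW.
    have Vp : 0 < V t `^ p by exact: powR_gt0.
    rewrite -[X in _ <= X]mul1r ler_pdivlMr // => H.
    have cD : D^-1 <= c `^ (p / g).
      rewrite /D powRN invrK ger_powR ?c0 // ler_pM2r ?invr_gt0 //; lra.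
    have tn : t ^+ 2 * (t `^ (n - 1) * t `^ alpha) <= t `^ ((n - 2) * p).
      rewrite -powRD ?lt0r_neq0 ?implybT // -powRS2 // ler_powR ?(ltW t1) //; lra.
    rewrite ler_pdivlMr ?exprn_gt0 //.
    have T0 : 0 <= t ^+ 2 * (t `^ (n - 1) * t `^ alpha).
      by rewrite !mulr_ge0 ?powR_ge0 // ltW.
    move: T0 tn H; move: (t `^ (n - 1) * t `^ alpha) => T.
    move: (t `^ _) => X T0 tX H.
    have {}H : D^-1 * (t ^+ 2 * T) * V t `^ p <= 1.
      apply: le_trans H; rewrite ler_wpM2r ?(ltW Vp) // ler_pM //.
      by rewrite invr_ge0 ltW.
    rewrite (_ : T * V t `^ p * t ^+ 2 = D * (D^-1 * (t ^+ 2 * T) * V t `^ p)).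
      by rewrite ler_piMr // ltW.
    by field; rewrite lt0r_neq0.
  - apply: cont_add.
      by apply: (hump_flux_cont B); rewrite (ltW s1).
    apply: cont_mul; first exact: cont_cst.
    exact: cinv ltr01.
  - apply: cont_add => //.
    apply: cont_mul; first exact: cont_cst.
    by apply: cinv; lra.
have D1 : 0 < D / b by rewrite divr_gt0 //; lra.
have f1 : flux dV 1 = - dV 1 by rewrite /flux normr1 powR1 mul1r.
split => //; last by move: H; rewrite f1 divr1; lra.
have s1b : s < 1 < b by lra.
apply: (lt_le_trans (hump_flux_gt0 B p1 s1b)).
apply: (drv_ndecr (ltW b1) (df := fun t => t `^ (n - 1) * t `^ alpha * V t `^ p)) => //.
- by move=> t tb; apply: (hump_fluxd B p1); lra.
- by move=> t tb; rewrite !mulr_ge0 ?powR_ge0.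
- by apply: (hump_flux_cont B); rewrite (ltW s1).
Qed.

End Flux.

(** * The next zone *)

Section Next.
Context {R : realType} (n alpha : R).
Hypotheses (n3 : 3 <= n) (alpha0 : 0 <= alpha).
Local Ltac slra := move: (n3) (alpha0); lra.
Local Ltac snra := move: (n3) (alpha0); nra.
Local Notation pcrit := (pcrit n alpha).
Local Notation ode := (ode n alpha).
Local Notation flux := (flux n).

(** A positive flux at [b] means [dV b < 0], so [V] is negative just after [b], and the absence of
    zeros propagates the sign. *)
Lemma after_zero_lt0 p L V dV (b b1 t : R) : ode p L V dV -> 0 < b -> b1 <= L ->
  V b = 0 -> 0 < flux dV b -> (forall t, b < t < b1 -> V t != 0) ->
  b < t < b1 -> V t < 0.
Proof.
move=> O b0 bL Vb fb V0 tb.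
have cV x : 0 < x < L -> {for x, continuous V}.
  by move=> xL; have [V1 _] := O x xL; exact: drv_continuous V1.
rewrite -oppr_gt0.
have [y by1 Vy] : exists2 y, b < y < b1 & 0 < - V y; last first.
  apply: (@no_zero_sign _ (fun t => - V t) b b1 _ _ y) => // x xb.
    by apply: cont_opp; apply: cV; lra.
  by rewrite oppr_eq0 V0.
have bbL : 0 < b < L by lra.
have db : dV b < 0.
  by move: fb; rewrite /flux oppr_gt0 pmulr_rlt0 // powR_gt0 // normr_gt0 gt_eqF.
have [V1 V2] := O b bbL.
have /cont_epsP/(_ (- dV b)) := drv_continuous V2.
rewrite oppr_gt0 => /(_ db)[d d0 Hd].
pose y := Num.min (b + d) t; have yt : y <= t by rewrite ge_min lexx orbT.
have yd : y <= b + d by rewrite ge_min lexx.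
have yb : b < y by rewrite lt_min; lra.
exists y; first by lra.
have [c cb E] : exists2 c, b < c < y & V y - V b = dV c * (y - b).
  apply: (@MVTc _ V dV b y yb).
  - by move=> x xb; have [] := O x; [lra|].
  - by apply: cV; lra.
  - by apply: cV; lra.
have : `|c - b| < d by rewrite gtr0_norm; lra.
move=> /Hd; rewrite ltr_norml => /andP[_ dc].
have dc0 : dV c < 0 by lra.
rewrite Vb subr0 in E; rewrite E -mulNr mulr_gt0 ?subr_gt0 //; lra.
Qed.

(** While [V < 0] the flux decreases, from at most [K] at [b] to 0 at [sg]. Integrating
    [- V' = flux * t^(1-n)] from [b] bounds the height [- V sg]. The last bound comes from the flux
    that must be consumed between [sg / 2] and [sg], where [- V] is at least half its height. *)
Lemma neg_hump p L V dV (b b1 sg K : R) : ode p L V dV -> 1 < p -> 0 < b ->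
  b < sg < b1 -> b1 <= L -> V b = 0 -> 0 < flux dV b <= K ->
  (forall t, b < t < b1 -> V t != 0) -> dV sg = 0 ->
  [/\ 0 < - V sg, - V sg <= K * b `^ (2 - n) &
   4 * b < sg -> (sg / 2) `^ (n + alpha) * (- V sg / 2) `^ p <= K].
Proof.
move=> O p1 b0 sgb bL Vb /andP[fb fK] V0 dsg.
have Vneg t : b < t < b1 -> V t < 0 by exact: after_zero_lt0 O b0 bL Vb fb V0.
have n20 : 0 < n - 2 by slra.
have bl x : b <= x < b1 -> 0 < x < L by lra.
have fd x : b <= x < b1 -> is_derive x 1 (flux dV)
    (- (x `^ (n - 1) * x `^ alpha * (- V x) `^ p)).
  move=> xb; have /andP[x0 _] := bl x xb.
  have := flux_der O (bl x xb).
  (* The formula also holds at the zero [b], because 0 to the power [p] is 0; the comparisons below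
     start there. *)
  have [xb'|xb'] := ltP b x; last first.
    have -> : x = b by lra.
    by rewrite Vb oppr0 powR0 ?mulr0 ?oppr0 // gt_eqF //; lra.
  have Vx : V x < 0 by apply: Vneg; rewrite xb'; lra.
  rewrite ltr0_norm // -[X in _ * (_ * X)]opprK mulrN mulrN (mulrC (_ `^ (p - 1))).
  by rewrite mulr_powRB1 // ?oppr_ge0 ?ltW //; lra.
have Wd x : b <= x < b1 -> is_derive x 1 (fun t => - V t) (flux dV x * x `^ (1 - n)).
  move=> xb; have /andP[x0 _] := bl x xb; have [V1 _] := O x (bl x xb).
  eapply drv_eq; first by der.
  rewrite /flux gtr0_norm // -(opprB n 1) powRN.
  have := lt0r_neq0 (powR_gt0 (n - 1) x0); move: (x `^ _) => y y0.
  by field.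
have fdec x y : b <= x -> x <= y -> y < b1 -> flux dV y <= flux dV x.
  move=> bx xy yb; apply: (drv_nincr xy
    (df := fun x => - (x `^ (n - 1) * x `^ alpha * (- V x) `^ p))) => [t ty|t ty||].
  - by apply: fd; lra.
  - by rewrite oppr_le0 !mulr_ge0 ?powR_ge0.
  - by apply: drv_continuous (fd x _); lra.
  - by apply: drv_continuous (fd y _); lra.
have fsg : flux dV sg = 0 by rewrite /flux dsg mulr0 oppr0.
have Wc x : b <= x < b1 -> {for x, continuous (fun t => - V t)}.
  by move=> xb; exact: drv_continuous (Wd x xb).
have Winc x y : b <= x -> x <= y -> y <= sg -> - V x <= - V y.
  move=> bx xy ysg; apply: (drv_ndecr xy (f := fun t => - V t)
    (df := fun x => flux dV x * x `^ (1 - n))) => [t ty|t ty||].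
  - by apply: Wd; lra.
  - by rewrite mulr_ge0 ?powR_ge0 // -fsg; apply: fdec; lra.
  - by apply: Wc; lra.
  - by apply: Wc; lra.
(* [- V] is compared with the radial harmonic function of flux [k]: [h k] increases while the flux
   is at least [k] and decreases once it is at most [k]. This says that [- V] is concave as a
   function of [- t^(2-n)]. *)
pose h (k t : R) := - V t + k / (n - 2) * t `^ (2 - n).
have hd k x : b <= x < b1 -> is_derive x 1 (h k) ((flux dV x - k) * x `^ (1 - n)).
  move=> xb; have /andP[x0 _] := bl x xb; have Wx := Wd x xb.
  rewrite /h; eapply drv_eq.
    by eapply (@drv_add _ (fun t => - V t)); [exact Wx|der].
  rewrite (_ : 2 - n = 1 + (1 - n)) ?powRS1 //=; last by ring.
  by field; rewrite !lt0r_neq0.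
have hinc k x y : b <= x -> x <= y -> y < b1 -> k <= flux dV y -> h k x <= h k y.
  move=> bx xy yb kf; apply: (drv_ndecr xy (f := h k)
    (df := fun x => (flux dV x - k) * x `^ (1 - n))) => [t ty|t ty||].
  - by apply: hd; lra.
  - rewrite mulr_ge0 ?powR_ge0 // subr_ge0 (le_trans kf) //; apply: fdec; lra.
  - by apply: drv_continuous (hd k x _); lra.
  - by apply: drv_continuous (hd k y _); lra.
have hdec k x y : b <= x -> x <= y -> y < b1 -> flux dV x <= k -> h k y <= h k x.
  move=> bx xy yb kf; apply: (drv_nincr xy (f := h k)
    (df := fun x => (flux dV x - k) * x `^ (1 - n))) => [t ty|t ty||].
  - by apply: hd; lra.
  - apply: mulr_le0_ge0; last exact: powR_ge0.
    rewrite subr_le0; apply: le_trans kf; apply: fdec; lra.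
  - by apply: drv_continuous (hd k x _); lra.
  - by apply: drv_continuous (hd k y _); lra.
have pw0 (k x : R) : 0 <= k -> 0 <= k / (n - 2) * x `^ (2 - n).
  by move=> k0; rewrite mulr_ge0 ?powR_ge0 // divr_ge0 // ltW.
have K0 : 0 < K by lra.
split.
- by rewrite oppr_gt0 Vneg.
- have [] : h K sg <= h K b by apply: hdec; lra.
  rewrite /h Vb oppr0 add0r => H.
  apply: le_trans (_ : K / (n - 2) * b `^ (2 - n) <= _).
    by have := pw0 K sg (ltW K0); lra.
  rewrite ler_wpM2r ?powR_ge0 // ler_pdivrMr // ler_peMr ?(ltW K0) //; slra.
move=> sgb4.
set k2 := flux dV (2 * b).
have k20 : 0 <= k2 by rewrite -fsg; apply: fdec; lra.
have H1 : h k2 b <= h k2 (2 * b) by apply: hinc; lra.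
have H2 : h k2 sg <= h k2 (2 * b) by apply: hdec; lra.
(* In the variable [- t^(2-n)] the step from [b] to [2 b] is at least as long as everything beyond
   [2 b], since [2 * 2^(2-n) <= 1]; by concavity [- V] gains at least as much in that step as
   afterwards. *)
have H3 : - V sg <= 2 * - V (2 * b).
  have P1 := pw0 k2 sg k20.
  have P2 : 2 * (k2 / (n - 2) * (2 * b) `^ (2 - n)) <= k2 / (n - 2) * b `^ (2 - n).
    rewrite mulrCA ler_wpM2l ?divr_ge0 ?(ltW n20) // powRM ?(ltW b0) // mulrA ler_piMl ?powR_ge0 //.
    rewrite -powRS1 // -[leRHS](powRr0 2) ler_powR //; slra.
  by move: H1 H2 P1 P2; rewrite /h Vb oppr0 add0r; lra.
(* The mean value theorem stands in for the integral of the source. Since [sg / 2 > 2 b] and [- V]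
   increases up to [sg], the point [c] inherits the bound of [H3]. *)
have [c csg E] : exists2 c, sg / 2 < c < sg & flux dV sg - flux dV (sg / 2) =
    - (c `^ (n - 1) * c `^ alpha * (- V c) `^ p) * (sg - sg / 2).
  apply: (@MVTc _ (flux dV) (fun c => - (c `^ (n - 1) * c `^ alpha * (- V c) `^ p)) (sg / 2) sg).
  - lra.
  - by move=> x xs; apply: fd; lra.
  - by apply: drv_continuous (fd _ _); lra.
  - by apply: drv_continuous (fd _ _); lra.
have W1 : - V sg / 2 <= - V c.
  have : - V (2 * b) <= - V c by apply: Winc; lra.
  by lra.
have Vsg : 0 < - V sg by rewrite oppr_gt0 Vneg.
have F1 : flux dV (sg / 2) <= K by apply: le_trans fK; apply: fdec; lra.
have s0 : 0 < sg / 2 by lra.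
have F2 : (sg / 2) `^ (n + alpha) = (sg / 2) `^ (n - 1) * (sg / 2) `^ alpha * (sg / 2).
  rewrite -powRD ?lt0r_neq0 ?implybT // (_ : n + alpha = 1 + (n - 1 + alpha)); last by ring.
  by rewrite powRS1 // mulrC.
have F3 : flux dV (sg / 2) = c `^ (n - 1) * c `^ alpha * (- V c) `^ p * (sg / 2).
  by move: E; rewrite fsg; move: (_ * (- V c) `^ p) => X; lra.
apply: le_trans F1; rewrite F3 F2.
move: s0 csg; set t := sg / 2; clearbody t => s0 csg.
have n10 : 0 <= n - 1 by slra.
have p0 : 0 <= p by lra.
have [/andP[/ltW tc _] t0] := (csg, ltW s0); have c0 := le_trans t0 tc.
have V20 : 0 <= - V sg / 2 by rewrite divr_ge0 // ltW.
have I1 : t `^ (n - 1) <= c `^ (n - 1) by exact: (ge0_ler_powR n10 t0 c0 tc).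
have I2 : t `^ alpha <= c `^ alpha by exact: (ge0_ler_powR alpha0 t0 c0 tc).
have I3 : (- V sg / 2) `^ p <= (- V c) `^ p.
  exact: (ge0_ler_powR p0 V20 (le_trans V20 W1) W1).
rewrite mulrAC ler_wpM2r ?(ltW s0) //.
by rewrite ler_pM ?mulr_ge0 ?powR_ge0 // ler_pM ?powR_ge0.
Qed.

(** When [sg] is comparable to [b], the height bound suffices: the product is at most
    [4 K^e b^(1 - e(n-2))], where [e(n-2)] equals 2 at the critical exponent and stays above 3/2
    nearby; [e <= 2] makes the power of [K] independent of [p]. *)
Lemma near_decay_small (K b sg M p : R) : 1 <= K -> 1 <= b -> 0 < M ->
  1 < p < pcrit -> pcrit - (n + alpha)^-1 <= p -> 0 < sg -> sg <= 4 * b ->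
  M <= K * b `^ (2 - n) ->
  sg * M `^ ((p - 1) / (2 + alpha)) <= 4 * K ^+ 2 / b `^ (2^-1).
Proof.
move=> K1 b1 M0 /andP[p1 pP] pd sg0 sgb MK.
have n20 : 0 < n - 2 by slra.
have na0 : 0 < n + alpha by slra.
have a20 : 0 < 2 + alpha by slra.
set e := (p - 1) / (2 + alpha).
have e0 : 0 <= e by rewrite divr_ge0 // ltW //; lra.
have eP : e * (n - 2) = 2 - (pcrit - p) * (n - 2) / (2 + alpha).
  by rewrite /e /pcrit; field; rewrite !lt0r_neq0.
have e2 : e <= 2.
  have : e * (n - 2) <= 2.
    rewrite eP gerBl; apply: divr_ge0; last exact: ltW.
    by apply: mulr_ge0; lra.
  by move: e0; snra.
have e32 : 3 / 2 <= e * (n - 2).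
  rewrite eP lerBrDr addrC -lerBrDr ler_pdivrMr //.
  have : (pcrit - p) * (n - 2) <= (n + alpha)^-1 * (n - 2).
    by rewrite ler_wpM2r ?(ltW n20) //; lra.
  have : (n + alpha)^-1 * (n - 2) <= 1.
    by rewrite mulrC ler_pdivrMr // mul1r; slra.
  slra.
have b0 : 0 < b by lra.
have Me : M `^ e <= K ^+ 2 * b `^ (- (3 / 2)).
  apply: (@le_trans _ _ ((K * b `^ (2 - n)) `^ e)).
    by apply: (ge0_ler_powR e0) => //; rewrite nnegrE ltW // mulr_gt0 ?powR_gt0 //; lra.
  rewrite powRM ?powR_ge0 //; last by lra.
  rewrite ler_pM ?powR_ge0 //.
    by rewrite -powR_mulrn ?ler_powR //; lra.
  by rewrite -powRrM ler_powR //; lra.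
apply: (@le_trans _ _ (4 * b * (K ^+ 2 * b `^ (- (3 / 2))))).
  by rewrite ler_pM ?powR_ge0 // ltW.
rewrite -powRN (_ : - 2^-1 = 1 + - (3 / 2)); last by field.
rewrite powRS1 // le_eqVlt; apply/orP; left; apply/eqP; ring.
Qed.

(** For [sg] far beyond [b] the height bound alone does not control [sg]. With [k = 1/(n+alpha)],
    the [k]-th power of the flux bound controls [sg M^(p k)], and the spare power [e - p k], equal
    to [k] at the critical exponent and at least [k / 2] nearby, is spent on [M <= K / b]. The
    factor 8 is [2 * 2^e] with [e <= 2]. *)
Lemma far_decay_small (K b sg M p : R) : 1 <= K -> K <= b -> 0 < M ->
  1 < p < pcrit -> pcrit - (n + alpha)^-1 / 2 <= p -> 0 < sg ->
  M <= K * b `^ (2 - n) ->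
  (sg / 2) `^ (n + alpha) * (M / 2) `^ p <= K ->
  sg * M `^ ((p - 1) / (2 + alpha)) <=
    8 * K * (K / b) `^ ((n + alpha)^-1 / 2).
Proof.
move=> K1 Kb M0 /andP[p1 pP] pd sg0 MK H.
have n20 : 0 < n - 2 by slra.
have na0 : 0 < n + alpha by slra.
have a20 : 0 < 2 + alpha by slra.
set e := (p - 1) / (2 + alpha).
have e0 : 0 <= e by rewrite divr_ge0 // ltW //; lra.
have eP : e * (n - 2) = 2 - (pcrit - p) * (n - 2) / (2 + alpha).
  by rewrite /e /pcrit; field; rewrite !lt0r_neq0.
have e2 : e <= 2.
  have : e * (n - 2) <= 2.
    rewrite eP gerBl; apply: divr_ge0; last exact: ltW.
    by apply: mulr_ge0; lra.
  by move: e0; snra.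
set k := (n + alpha)^-1.
have k0 : 0 < k by rewrite invr_gt0.
have k1 : k <= 1 by rewrite invf_le1 //; slra.
have ek : k / 2 <= e - p * k.
  have -> : e - p * k = k - (pcrit - p) * ((2 + alpha)^-1 - k).
    by rewrite /e /k /pcrit; field; rewrite !lt0r_neq0.
  have : (2 + alpha)^-1 <= 1 by rewrite invf_le1 //; slra.
  move: pd; rewrite -/k; nra.
set t := sg / 2 in H *; set a := M / 2 in H *.
have t0 : 0 < t by rewrite divr_gt0.
have a0 : 0 < a by rewrite divr_gt0.
have sgE : sg = 2 * t by rewrite /t; field.
have ME : M = 2 * a by rewrite /a; field.
clearbody t a.
have b1 : 1 <= b by lra.
have aKb : a <= K / b.
  apply: (@le_trans _ _ M); first by lra.
  apply: le_trans MK _; rewrite ler_wpM2l //; first lra.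
  by rewrite -powR_inv1 ?ler_powR //; slra.
have Kb1 : K / b <= 1 by rewrite ler_pdivrMr ?mul1r //; lra.
have ta : t * a `^ (p * k) <= K.
  have : (t `^ (n + alpha) * a `^ p) `^ k <= K `^ k.
    by apply: (ge0_ler_powR (ltW k0)) => //; rewrite nnegrE ?mulr_ge0 ?powR_ge0 //; lra.
  rewrite powRM ?powR_ge0 // -!powRrM divff ?lt0r_neq0 // powRr1 ?(ltW t0) //.
  by move=> /le_trans; apply; rewrite ler1_powR.
have tae : t * a `^ e <= K * (K / b) `^ (k / 2).
  have -> : a `^ e = a `^ (p * k) * a `^ (e - p * k).
    by rewrite -powRD ?lt0r_neq0 ?implybT // subrKC.
  rewrite mulrA.
  apply: ler_pM => //; rewrite ?mulr_ge0 ?powR_ge0 ?(ltW t0) //.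
  apply: (@le_trans _ _ (a `^ (k / 2))).
    by rewrite ger_powR // a0 (le_trans aKb).
  have k20 : 0 <= k / 2 by lra.
  by apply: (ge0_ler_powR k20); rewrite ?nnegrE ?divr_ge0 //; lra.
have -> : sg * M `^ e = 2 * 2 `^ e * (t * a `^ e).
  rewrite sgE ME powRM ?(ltW a0) //; ring.
have e4 : 2 `^ e <= 4.
  by apply: (@le_trans _ _ (2 `^ 2)); [rewrite ler_powR //; lra|rewrite powR_mulrn //; lra].
have te0 : 0 <= t * a `^ e by rewrite mulr_ge0 ?powR_ge0 ?ltW.
have := powR_ge0 2 e.
by move: (2 `^ e) (t * _) e4 te0 tae => x y x4 y0 yy x0; nra.
Qed.
End Next.

Section NextExtremum.
Context {R : realType} (n alpha : R).
Hypotheses (n3 : 3 <= n) (alpha0 : 0 <= alpha).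
Local Ltac slra := move: (n3) (alpha0); lra.
Local Notation pcrit := (pcrit n alpha).
Local Notation hump := (hump n alpha).

(** The quantity bounded is the radius of the next extremum in the scale of its own zone, that is,
    the next [s]. The cases [sg <= 4 b] and [sg > 4 b] are handled by the near and the far
    estimate. *)
Lemma next_extremum (eps : R) : 0 < eps -> exists2 d, 0 < d &
  forall p L V dV s b b1 sg, 1 < p -> pcrit - d < p < pcrit -> s < d ->
  hump p L V dV s b -> b < sg < b1 -> b1 <= L ->
  (forall t, b < t < b1 -> V t != 0) -> dV sg = 0 ->
  sg * `|V sg| `^ ((p - 1) / (2 + alpha)) < eps.
Proof.
move=> eps0; have [d1 [K [d10 K1 HF]]] := hump_flux_bound n3 alpha0.
have na0 : 0 < n + alpha by slra.
have K0 : 0 < K by lra.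
(* A sum of thresholds for [b]: the far estimate needs [K <= b], and the last two terms are obtained
   by solving for [b] the requirement that the near and far bounds be less than [eps]. *)
pose b0 := 1 + K + (4 * K ^+ 2 / eps) ^+ 2 + K * (8 * K / eps) `^ (2 * (n + alpha)).
have Q1 : 0 <= (4 * K ^+ 2 / eps) ^+ 2 by exact: sqr_ge0.
have Q2 : 0 <= K * (8 * K / eps) `^ (2 * (n + alpha)).
  by rewrite mulr_ge0 ?powR_ge0 // ltW.
have b00 : 0 < b0 by rewrite /b0; lra.
have [d2 d20 HC] := hump_conv n3 alpha0 b00 ltr01.
pose d3 := (n + alpha)^-1 / 2.
have d30 : 0 < d3 by rewrite divr_gt0 // invr_gt0.
exists (Num.min d1 (Num.min d2 d3)); first by rewrite !lt_min d10 d20.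
move=> p L V dV s b b1 sg p1 /andP[pd pP]; rewrite !lt_min => /and3P[sd1 sd2 sd3].
move=> B sgb b1L V0 dsg.
have pd1 : pcrit - d1 < p.
  by apply: le_lt_trans pd; rewrite lerD2l lerN2 !ge_min lexx.
have pd2 : pcrit - d2 < p.
  by apply: le_lt_trans pd; rewrite lerD2l lerN2 !ge_min lexx orbT.
have pd3 : pcrit - d3 < p.
  by apply: le_lt_trans pd; rewrite lerD2l lerN2 !ge_min lexx !orbT.
have bL : b < L by lra.
have [|b1' fb0 fbK] := HF p L V dV s b p1 _ sd1 B bL; first by rewrite pd1.
have [|bb _] := HC p L V dV s b p1 _ sd2 B; first by rewrite pd2.
have bp : 0 < b by lra.
have pp : 1 < p < pcrit by rewrite p1.
have fb : 0 < flux n dV b <= K by rewrite fb0.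
have [M0 M1 M2] := neg_hump n3 alpha0 (hump_ode B) p1 bp sgb b1L (hump_Vb B) fb V0 dsg.
rewrite -normrN gtr0_norm //.
have sg0 : 0 < sg by lra.
have [sgb4|/M2 {}M2] := leP sg (4 * b).
  have pd4 : pcrit - (n + alpha)^-1 <= p by rewrite /d3 in pd3 d30; lra.
  apply: (le_lt_trans (near_decay_small n3 alpha0 K1 (ltW b1') M0 pp pd4 sg0 sgb4 M1)).
  rewrite powR12_sqrt ?(ltW bp) // ltr_pdivrMr ?sqrtr_gt0 //.
  rewrite -ltr_pdivrMl // (mulrC eps^-1).
  have X1 : 0 <= 4 * K ^+ 2 / eps.
    by apply: divr_ge0; [apply: mulr_ge0 => //; exact: sqr_ge0|exact: ltW].
  rewrite -(ger0_norm X1) -sqrtr_sqr ltr_sqrt //; apply: le_lt_trans bb; rewrite /b0; lra.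
have Kb : K <= b by rewrite /b0 in bb; lra.
have X0 : 0 < 8 * K / eps by rewrite divr_gt0 // mulr_gt0.
apply: (le_lt_trans (far_decay_small n3 alpha0 K1 Kb M0 pp (ltW pd3) sg0 M1 M2)).
rewrite mulrC -ltr_pdivlMr ?mulr_gt0 //.
have -> : eps / (8 * K) = ((8 * K / eps)^-1 `^ (2 * (n + alpha))) `^ ((n + alpha)^-1 / 2).
  rewrite -powRrM (_ : _ * (_ / 2) = 1); last by field; rewrite lt0r_neq0.
  by rewrite powRr1 ?invr_ge0 ?(ltW X0) // invf_div.
apply: (gt0_ltr_powR d30).
- by rewrite nnegrE divr_ge0 ?ltW.
- by rewrite nnegrE powR_ge0.
have : K * (8 * K / eps) `^ (2 * (n + alpha)) < b by rewrite /b0 in bb; lra.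
rewrite ltr_pdivrMr // -(powR_inv1 (ltW X0)) -powRrM mulN1r powRN.
by rewrite (mulrC _ b) ltr_pdivlMr ?powR_gt0.
Qed.
End NextExtremum.

(** * From the partial differential equation to the radial equation *)

Section Radial.
Context {R : realType} {N : nat}.
Local Notation V := 'rV[R]_N.
Implicit Types (x y v : V) (f : V -> R).

Lemma enorm_ge0 x : 0 <= enorm x.
Proof. exact: sqrtr_ge0. Qed.

Lemma enorm_sqr x : enorm x ^+ 2 = \sum_(i < N) x ord0 i ^+ 2.
Proof. by rewrite sqr_sqrtr // sumr_ge0 // => i _; exact: sqr_ge0. Qed.

Lemma enormZ (c : R) x : enorm (c *: x) = `|c| * enorm x.
Proof.
rewrite /enorm -sqrtr_sqr -sqrtrM ?sqr_ge0 // mulr_sumr; congr Num.sqrt.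
by apply: eq_bigr => i _; rewrite mxE exprMn.
Qed.

Lemma evecE (j i : 'I_N) : evec R j ord0 i = (i == j)%:R.
Proof. by rewrite mxE eqxx. Qed.

Lemma enorm_line (s : R) (j : 'I_N) x :
  enorm (s *: evec R j + x) = Num.sqrt (enorm x ^+ 2 + (2 * s * x ord0 j + s ^+ 2)).
Proof.
rewrite enorm_sqr /enorm; congr Num.sqrt.
rewrite [in LHS](bigD1 j) //= [in RHS](bigD1 j) //= !mxE !eqxx mulr1.
rewrite (eq_bigr (fun i => x ord0 i ^+ 2)); first by ring.
by move=> i /negPf ij; rewrite !mxE ij andbF mulr0 add0r.
Qed.

Lemma enorm_evec (j : 'I_N) : enorm (evec R j) = 1.
Proof.
rewrite /enorm (bigD1 j) //= big1 ?evecE ?eqxx ?addr0 ?expr1n ?sqrtr1 //.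
by move=> i /negPf ij; rewrite evecE ij expr0n.
Qed.

Lemma enormZ_evec (s : R) (j : 'I_N) : enorm (s *: evec R j) = `|s|.
Proof. by rewrite enormZ enorm_evec mulr1. Qed.

Lemma coord_le_enorm x (j : 'I_N) : `|x ord0 j| <= enorm x.
Proof.
rewrite -sqrtr_sqr ler_sqrt; last by rewrite sumr_ge0 // => i _; exact: sqr_ge0.
by rewrite (bigD1 j) //= lerDl sumr_ge0 // => i _; exact: sqr_ge0.
Qed.

Lemma enorm_eq0 x : enorm x = 0 -> x = 0.
Proof.
move=> x0; apply/rowP => j; rewrite mxE; apply/eqP; rewrite -normr_le0 -x0.
exact: coord_le_enorm.
Qed.

Lemma line_is_derive f y v (t l : R) :
  is_derive t 1 (fun s : R => f (s *: v + y)) l <-> is_derive (t *: v + y) v f l.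
Proof.
have E : (fun h : R => h^-1 *: (((fun s : R => f (s *: v + y)) \o shift t) (h *: (1 : R)) - f (t *: v + y)))
       = (fun h => h^-1 *: ((f \o shift (t *: v + y)) (h *: v) - f (t *: v + y))).
  apply/funext => h /=; congr (_ *: (f _ - _)).
  by rewrite [h *: 1]mulr1 scalerDl addrA.
by split; case=> D1 D2; split; move: D1 D2; rewrite /derivable /derive /= E.
Qed.

Lemma radial_is_derive f (g : R -> R) x (j : 'I_N) (dg : R) :
  (forall z, f z = g (enorm z)) -> x != 0 -> is_derive (enorm x) 1 g dg ->
  is_derive x (evec R j) f (dg * (x ord0 j / enorm x)).
Proof.
move=> fg xn0 gd.
have ex0 : 0 < enorm x.
  rewrite lt_neqAle enorm_ge0 andbT eq_sym; apply/eqP => /enorm_eq0 x0.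
  by rewrite x0 eqxx in xn0.
rewrite -[x in is_derive x](add0r x) -(scale0r (evec R j)).
apply/line_is_derive.
have -> : (fun s : R => f (s *: evec R j + x)) =
   (fun s => g (Num.sqrt (enorm x ^+ 2 + (2 * s * x ord0 j + s ^+ 2)))).
  by apply/funext => s; rewrite fg enorm_line.
have E0 : enorm x ^+ 2 + (2 * 0 * x ord0 j + 0 ^+ 2) = enorm x ^+ 2 by ring.
have H1 : is_derive (0:R) (1:R) (fun s => enorm x ^+ 2 + (2 * s * x ord0 j + s ^+ 2)) (2 * x ord0 j).
  eapply drv_eq; first by der.
  by rewrite /=; ring.
have H2 : is_derive (enorm x ^+ 2 + (2 * 0 * x ord0 j + 0 ^+ 2)) (1:R) Num.sqrt
    (2 * enorm x)^-1.
  rewrite E0; eapply drv_eq; first by apply: is_derive1_sqrt; rewrite exprn_gt0.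
  by rewrite sqrtr_sqr gtr0_norm.
have H3 := drv_comp (f := fun s => enorm x ^+ 2 + (2 * s * x ord0 j + s ^+ 2)) H2 H1.
eapply drv_eq.
  apply: (drv_comp (g := g) _ H3); rewrite E0 sqrtr_sqr (gtr0_norm ex0); exact: gd.
by field; rewrite lt0r_neq0.
Qed.

Lemma radial_is_derive0 f (j : 'I_N) (l : R) :
  is_derive (0:R) 1 (fun s : R => f (s *: evec R j)) l -> is_derive 0 (evec R j) f l.
Proof.
have -> : (fun s : R => f (s *: evec R j)) = (fun s => f (s *: evec R j + 0)).
  by apply/funext => s; rewrite addr0.
by move=> /line_is_derive; rewrite scale0r addr0.
Qed.

Lemma even_is_derive0 (g : R -> R) (l : R) : (forall t, g (- t) = g t) ->
  is_derive (0:R) 1 g l -> l = 0.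
Proof.
move=> gE gd.
have gd' : is_derive (- (0:R)) 1 g l by rewrite oppr0.
have H := drv_comp (f := fun t : R => - t) gd' (drv_opp (drv_id 0)).
have {}H : is_derive (0:R) 1 g (- l).
  move: H; rewrite mulrN1; congr is_derive; apply/funext => t; exact: gE.
case: gd => _ E1; case: H => _ E2.
by move: E2; rewrite E1 => E2; lra.
Qed.

End Radial.

Section RadialOde.
Context {R : realType} {N : nat} (i0 : 'I_N).
Variables (alpha p : R) (u : 'rV[R]_N -> R).
Hypotheses (usol : dirichlet_solution alpha p u) (urad : radial u).

(** Taken along a full line through the origin, so that the profile is even and its derivative at 0
    is an ordinary two-sided one. *)
Definition profile (t : R) : R := u (t *: evec R i0).
Definition dprofile (t : R) : R := 'D_(evec R i0) u (t *: evec R i0).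

Lemma profile_enorm x : u x = profile (enorm x).
Proof. by apply: urad; rewrite enormZ_evec ger0_norm ?enorm_ge0. Qed.

Lemma profileN t : profile (- t) = profile t.
Proof. by apply: urad; rewrite !enormZ_evec normrN. Qed.

Lemma line_diff (f : 'rV[R]_N -> R) (j : 'I_N) (t : R) y :
  differentiable f (t *: evec R j + y) ->
  is_derive t 1 (fun s : R => f (s *: evec R j + y)) ('D_(evec R j) f (t *: evec R j + y)).
Proof.
move=> fd; apply/line_is_derive; split => //.
exact: diff_derivable.
Qed.

Lemma line_diff0 (f : 'rV[R]_N -> R) (j : 'I_N) (t : R) :
  differentiable f (t *: evec R j) ->
  is_derive t 1 (fun s : R => f (s *: evec R j)) ('D_(evec R j) f (t *: evec R j)).
Proof.
move=> fd; have := @line_diff f j t 0; rewrite addr0 => /(_ fd).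
by congr is_derive; apply/funext => s; rewrite addr0.
Qed.

Lemma ball_evec (t : R) (j : 'I_N) : `|t| < 1 -> @unit_ball R N (t *: evec R j).
Proof. by rewrite /unit_ball /= enormZ_evec. Qed.

Lemma profile_der (t : R) : `|t| < 1 -> is_derive t 1 profile (dprofile t).
Proof.
move=> t1; apply: line_diff0; case: usol => -[_ _ ud _ _] _.
by apply: ud; exact: ball_evec.
Qed.

Lemma dprofile_der (t : R) : `|t| < 1 ->
  is_derive t 1 dprofile ('D_(evec R i0) ('D_(evec R i0) u) (t *: evec R i0)).
Proof.
move=> t1; apply: (@line_diff0 ('D_(evec R i0) u)); case: usol => -[_ _ _ udd _] _.
by apply: udd; exact: ball_evec.
Qed.

Lemma dprofile0 : dprofile 0 = 0.
Proof.
apply: (even_is_derive0 profileN); apply: profile_der.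
by rewrite normr0 ltr01.
Qed.

Lemma profile_cont (t : R) : `|t| <= 1 -> {for t, continuous profile}.
Proof.
move=> t1; case: usol => -[uc _ _ _ _] _.
apply: (@continuous_comp _ _ _ (fun s : R => s *: evec R i0) u).
  exact: scalel_continuous.
by apply: uc; rewrite enormZ_evec.
Qed.

Lemma dprofile_cont (t : R) : `|t| < 1 -> {for t, continuous dprofile}.
Proof. by move=> t1; exact: drv_continuous (dprofile_der t1). Qed.

(** At distance [s] from the axis in direction [j], with [w = sqrt (r^2 + s^2)], the partial
    derivative is [phi'(w) s / w]. Since [w'(0) = 0], its derivative at [s = 0] is [phi'(r) / r].
    The [N - 1] transverse directions thus produce the first-order term of the radial equation. *)
Lemma D2_cross (j : 'I_N) (r : R) : j != i0 -> 0 < r < 1 ->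
  'D_(evec R j) ('D_(evec R j) u) (r *: evec R i0) = dprofile r / r.
Proof.
move=> ji r01; have /andP[r0 r1] := r01.
have rn0 : r != 0 by rewrite gt_eqF.
have rx : `|r| < 1 by rewrite gtr0_norm.
pose w (s : R) := Num.sqrt (r ^+ 2 + s ^+ 2).
have wE s : enorm (s *: evec R j + r *: evec R i0) = w s.
  rewrite enorm_line enormZ_evec /w real_normK ?num_real // !mxE (negPf ji) andbF.
  by rewrite !mulr0 add0r.
have w0 : w 0 = r by rewrite /w expr0n addr0 sqrtr_sqr gtr0_norm.
have wd : is_derive (0:R) 1 w 0.
  have H1 : is_derive (0:R) (1:R) (fun s => r ^+ 2 + s ^+ 2) 0.
    eapply drv_eq; first by der.
    by rewrite /=; ring.
  have H2 : is_derive (r ^+ 2 + 0 ^+ 2) (1:R) Num.sqrt (2 * Num.sqrt (r ^+ 2 + 0 ^+ 2))^-1.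
    by apply: is_derive1_sqrt; rewrite expr0n addr0 exprn_gt0.
  have := drv_comp (f := fun s => r ^+ 2 + s ^+ 2) H2 H1.
  by rewrite mulr0.
have wr : is_derive (w 0) 1 dprofile ('D_(evec R i0) ('D_(evec R i0) u) (r *: evec R i0)).
  by rewrite w0; exact: dprofile_der.
have Hd : is_derive (0:R) 1 (fun s => dprofile (w s) * (s / w s)) (dprofile r / r).
  have H1 := drv_comp wr wd.
  eapply drv_eq.
    apply: (drv_mul H1); apply: (drv_mul (drv_id 0)).
    by apply: (drv_inverse _ wd); rewrite w0.
  by rewrite /= w0; field.
have Hn : \forall s \near (0:R), dprofile (w s) * (s / w s) =
    'D_(evec R j) u (s *: evec R j + r *: evec R i0).
  have wlt : \forall s \near (0:R), w s < 1.
    have := drv_continuous wd; rewrite /prop_for /continuous_at w0 => wc.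
    exact: (wc _ (lt_nbhsl r1)).
  apply: filterS wlt => s ws; set z := _ + _.
  have wz : enorm z = w s by rewrite /z wE.
  have wp : 0 < w s by rewrite sqrtr_gt0 ltr_wpDr ?sqr_ge0 // exprn_gt0.
  have zn0 : z != 0.
    apply/eqP => z0; move: wp; rewrite -wz z0.
    by rewrite -(scale0r (evec R i0)) enormZ_evec normr0 ltxx.
  have ed : is_derive (enorm z) 1 profile (dprofile (enorm z)).
    by apply: profile_der; rewrite ger0_norm ?enorm_ge0 // wz.
  have [_ ->] := @radial_is_derive _ _ u profile z j _ profile_enorm zn0 ed.
  rewrite wz /z !mxE eqxx (negPf ji) /=.
  by congr (_ * (_ / _)); rewrite !(eqxx, mulr1, mulr0, addr0).
have := drv_near Hn Hd.
move=> /(line_is_derive ('D_(evec R j) u) (r *: evec R i0)) [_ <-].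
by rewrite scale0r add0r.
Qed.

Lemma profile_ode : ode N%:R alpha p 1 profile dprofile.
Proof.
move=> r r01; have /andP[r0 r1] := r01.
have rx : `|r| < 1 by rewrite gtr0_norm.
split; first exact: profile_der.
eapply drv_eq; first exact: dprofile_der.
case: usol => -[_ _ _ _ upde] _.
have := upde _ (ball_evec i0 rx).
rewrite /laplacian (bigD1 i0) //= (eq_bigr (fun=> dprofile r / r)); last first.
  by move=> j ji; exact: D2_cross.
rewrite sumr_const cardC1 card_ord enormZ_evec gtr0_norm // -/(profile r).
have -> : (dprofile r / r) *+ N.-1 = (N%:R - 1) / r * dprofile r.
  have N0 : (0 < N)%N by exact: leq_ltn_trans (leq0n i0) (ltn_ord i0).
  by rewrite -mulr_natl -subn1 natrB // -[RHS]mulrA [r^-1 * _]mulrC.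
by move: ('D_ _ _ _) => D; lra.
Qed.
End RadialOde.

(** Two derivatives bring [lam^-2], the weight [lam^-alpha] and the nonlinearity [|k|^(p-1)]; the
    condition on [k] and [lam] is the balance between them. *)
Lemma ode_scale {R : realType} (n alpha p L k lam : R) (phi dphi : R -> R) :
  ode n alpha p L phi dphi -> 0 < lam -> `|k| `^ (p - 1) * lam `^ (2 + alpha) = 1 ->
  ode n alpha p (L * lam) (fun t => k * phi (t / lam)) (fun t => k / lam * dphi (t / lam)).
Proof.
move=> O lam0 klam t /andP[t0 tL].
have tlam : 0 < t / lam < L by rewrite divr_gt0 //= ltr_pdivrMr.
have [V1 V2] := O _ tlam.
have D : is_derive t (1:R) (fun t => t / lam) lam^-1.
  by eapply drv_eq; [der|rewrite /= mulr0 add0r mulr1].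
have D1 := drv_comp (f := fun t => t / lam) V1 D.
have D2 := drv_comp (f := fun t => t / lam) V2 D.
have ln0 := lt0r_neq0 lam0; have tn0 := lt0r_neq0 t0.
split.
  eapply drv_eq; first by apply: (drv_mul (drv_cst _ _) D1).
  by rewrite /=; field.
eapply drv_eq; first by apply: (drv_mul (drv_cst _ _) D2).
have li0 : 0 <= lam^-1 by rewrite invr_ge0 ltW.
rewrite normrM (powRM _ (normr_ge0 k) (normr_ge0 _)) (powRM _ (ltW t0) li0).
have la0 : lam `^ alpha != 0 by rewrite lt0r_neq0 // powR_gt0.
have -> : lam^-1 `^ alpha = (lam `^ alpha)^-1.
  by rewrite -(powR_inv1 (ltW lam0)) -powRrM mulN1r powRN.
rewrite powRS2 // in klam.
have -> : `|k| `^ (p - 1) = (lam ^+ 2 * lam `^ alpha)^-1.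
  by apply: (mulIf (mulf_neq0 (expf_neq0 2 ln0) la0)); rewrite klam mulVf // mulf_neq0 ?expf_neq0.
by rewrite /=; field; rewrite ln0 tn0 la0.
Qed.

(** * Nodal zones *)

(* The central zone is the symmetric interval [(- r 1, r 1)]. *)
Definition zlo {R : realType} (r : nat -> R) (i : nat) : R :=
  if i == 0%N then - r 1 else r i.

Record radial_zones {R : realType} (n alpha p : R) (m : nat) (phi dphi : R -> R)
    (r mu sigma : nat -> R) : Prop := RadialZones {
  zones_p : 1 < p;
  zones_ode : ode n alpha p 1 phi dphi;
  zones_cont : forall t : R, `|t| <= 1 -> {for t, continuous phi};
  zones_dcont : forall t : R, `|t| < 1 -> {for t, continuous dphi};
  zones_d0 : dphi 0 = 0;
  zones_m : (1 <= m)%N;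
  zones_r1 : 0 < r 1;
  zones_incr : forall i, (1 <= i < m)%N -> r i < r i.+1;
  zones_last : r m = 1;
  zones_zeros : forall t : R, `|t| <= 1 ->
    (phi t = 0 <-> exists2 i, (1 <= i <= m)%N & `|t| = r i);
  zones_max : forall i, (i < m)%N ->
    [/\ 0 <= sigma i, zlo r i < sigma i < r i.+1, `|phi (sigma i)| = mu i &
      forall t : R, 0 <= t -> zlo r i < t < r i.+1 -> `|phi t| <= mu i] }.

Section Zones.
Context {R : realType} (n alpha p : R) (m : nat) (phi dphi : R -> R).
Variables (r mu sigma : nat -> R).
Hypotheses (n3 : 3 <= n) (alpha0 : 0 <= alpha).
Hypothesis Z : radial_zones n alpha p m phi dphi r mu sigma.
Local Notation zlo := (zlo r).
Let phi_ode := zones_ode Z.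
Let phi_cont := zones_cont Z.
Let dphi_cont := zones_dcont Z.
Let dphi0 := zones_d0 Z.
Let r_gt0 := zones_r1 Z.
Let r_incr := zones_incr Z.
Let r_last := zones_last Z.
Let phi_zeros := zones_zeros Z.
Let phi_max := zones_max Z.

(** In the central zone [sigma 0] is only some radius where the maximum is attained; the centre,
    which attains it too, is used instead so that the induction starts from 0. *)
Definition zcrit (i : nat) : R := if i == 0%N then 0 else sigma i.
Definition zscale (i : nat) : R := mu i `^ ((p - 1) / (2 + alpha)).
(** The sign makes every rescaled zone positive, so that zones of both signs become humps. *)
Definition zfac (i : nat) : R := Num.sg (phi (zcrit i)) / mu i.
Definition zV (i : nat) (t : R) : R := zfac i * phi (t / zscale i).
Definition zdV (i : nat) (t : R) : R := zfac i / zscale i * dphi (t / zscale i).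

Lemma r_mono i j : (1 <= i)%N -> (i <= j <= m)%N -> r i <= r j.
Proof.
move=> i1 /andP[]; elim: j => [|j IH]; first by rewrite leqn0 => /eqP ->.
rewrite leq_eqVlt => /predU1P[-> //|]; rewrite ltnS => ij jm.
apply: le_trans (IH ij (ltnW jm)) _; apply/ltW/r_incr.
by rewrite jm (leq_trans i1).
Qed.

Lemma r_le1 i : (1 <= i <= m)%N -> r i <= 1.
Proof. by move=> /andP[i1 im]; rewrite -r_last r_mono // im leqnn. Qed.

Lemma r_pos i : (1 <= i <= m)%N -> 0 < r i.
Proof. by move=> /andP[i1 im]; apply: lt_le_trans r_gt0 _; rewrite r_mono // i1. Qed.

Lemma zlo_bnd i t : (i < m)%N -> zlo i < t < r i.+1 -> `|t| < 1.
Proof.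
move=> im /andP[lt tr]; have r1 : r i.+1 <= 1 by exact: r_le1.
rewrite ltr_norml (lt_le_trans tr r1) andbT.
move: lt; rewrite /zlo; case: eqP => [i0|/eqP i0] lt.
  by move: r1; rewrite i0; lra.
have : 0 < r i by apply: r_pos; rewrite lt0n i0 ltnW.
lra.
Qed.

Lemma zone_neq0 i t : (i < m)%N -> zlo i < t < r i.+1 -> phi t != 0.
Proof.
move=> im tI; apply/negP => /eqP pt.
have t1 := zlo_bnd im tI.
have [k /andP[k1 km] tk] := (phi_zeros (ltW t1)).1 pt.
have rk1 : r 1 <= r k by rewrite r_mono // k1.
move: tI; rewrite /zlo; case: eqP => [i0|/eqP i0] /andP[lt tr].
  have : `|t| < r 1 by rewrite ltr_norml lt -i0.
  by rewrite tk ltNge rk1.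
have rp : 0 < r i by apply: r_pos; rewrite lt0n i0 ltnW.
have {}tk : t = r k by rewrite -tk gtr0_norm // (lt_trans rp).
have [ki|ik] := leqP k i.
  by have : r k <= r i by [rewrite r_mono // ki ltnW]; rewrite -tk leNgt lt.
by have : r i.+1 <= r k by [rewrite r_mono // ik]; rewrite -tk leNgt tr.
Qed.

Lemma zcrit_in i : (i < m)%N -> zlo i < zcrit i < r i.+1.
Proof.
move=> im; rewrite /zcrit; case: eqP => [->|i0].
  by rewrite /zlo eqxx; have := r_gt0; lra.
by have [] := phi_max im.
Qed.

Lemma zcrit_ge0 i : (i < m)%N -> 0 <= zcrit i.
Proof. by move=> im; rewrite /zcrit; case: eqP => // _; have [] := phi_max im. Qed.

Lemma mu_gt0 i : (i < m)%N -> 0 < mu i.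
Proof.
move=> im; have [_ sI <- _] := phi_max im.
by rewrite normr_gt0 (zone_neq0 im).
Qed.

Lemma zscale_gt0 i : (i < m)%N -> 0 < zscale i.
Proof. by move=> im; rewrite powR_gt0 // mu_gt0. Qed.

Lemma zfac_norm i : (i < m)%N -> `|zfac i| = (mu i)^-1.
Proof.
move=> im; rewrite normrM normr_sg (zone_neq0 im (zcrit_in im)) mul1r.
by rewrite gtr0_norm // invr_gt0 mu_gt0.
Qed.

Lemma zV_ode i : (i < m)%N -> ode n alpha p (zscale i) (zV i) (zdV i).
Proof.
move=> im; rewrite -[zscale i]mul1r; apply: (ode_scale phi_ode); first exact: zscale_gt0.
have mu0 := mu_gt0 im.
rewrite zfac_norm // /zscale -powRrM divfK; last by rewrite gt_eqF //; move: (alpha0); lra.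
rewrite -powRM ?invr_ge0 ?ltW // mulVf ?lt0r_neq0 // powR1 //.
Qed.

Lemma zfac_phi_gt0 i t : (i < m)%N -> zlo i < t < r i.+1 -> 0 < zfac i * phi t.
Proof.
move=> im tI.
apply: (@no_zero_sign _ (fun x => zfac i * phi x) (zlo i) (r i.+1) _ _ (zcrit i) _) => //.
- move=> x xI; apply: cont_mul; first exact: cont_cst.
  by apply/phi_cont/ltW; exact: (zlo_bnd im xI).
- move=> x xI; rewrite mulf_neq0 ?(zone_neq0 im xI) //.
  by rewrite -normr_gt0 zfac_norm // invr_gt0 mu_gt0.
- exact: zcrit_in.
rewrite /zfac mulrAC -normrEsg divr_gt0 ?mu_gt0 // normr_gt0 (zone_neq0 im) //.
exact: zcrit_in.
Qed.

Lemma zfac_phiE i t : (i < m)%N -> zlo i < t < r i.+1 -> zfac i * phi t = `|phi t| / mu i.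
Proof.
by move=> im tI; rewrite -(gtr0_norm (zfac_phi_gt0 im tI)) normrM zfac_norm // mulrC.
Qed.

Lemma zfac_phi_le1 i t : (i < m)%N -> 0 <= t -> zlo i < t < r i.+1 ->
  zfac i * phi t <= 1.
Proof.
move=> im t0 tI; rewrite zfac_phiE // ler_pdivrMr ?mu_gt0 // mul1r.
by have [_ _ _] := phi_max im; exact.
Qed.

(** Inside the zone [|phi| / mu i] coincides with the differentiable function [zfac i * phi], to
    which the interior maximum criterion applies. *)
Lemma dphi_sigma i : (i < m)%N -> i != 0%N -> dphi (sigma i) = 0.
Proof.
move=> im i0.
have [s0 sI smu smax] := phi_max im.
have rp : 0 < r i by apply: r_pos; rewrite lt0n i0 ltnW.
have zE : zlo i = r i by rewrite /zlo (negPf i0).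
have rI t : t \in `](r i), (r i.+1)[%R -> zlo i < t < r i.+1 /\ 0 < t < 1.
  rewrite in_itv /= zE => tI; split => //; have /andP[t0 _] := tI.
  rewrite (lt_trans rp t0) /=; have : zlo i < t < r i.+1 by rewrite zE.
  by move=> /(zlo_bnd im); apply: le_lt_trans; exact: ler_norm.
have D (t : R) : 0 < t < 1 -> is_derive t 1 (fun t => zfac i * phi t) (zfac i * dphi t).
  move=> t01; have [V1 _] := phi_ode t01.
  eapply drv_eq; first by apply: (drv_mul (drv_cst _ _) V1).
  by rewrite /= mulr0 addr0.
have sI' : sigma i \in `](r i), (r i.+1)[%R by rewrite in_itv /= -zE.
have H : is_derive (sigma i) 1 (fun t => zfac i * phi t) 0.
  apply: (derive1_at_max _ _ sI').
  - by apply: ltW; move: sI; rewrite zE; lra.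
  - by move=> t /rI[_ /D[]].
  - move=> t /rI[tI /andP[t0 _]].
    by rewrite zfac_phiE // zfac_phiE // smu ler_pM2r ?invr_gt0 ?mu_gt0 // smax // ltW.
have [_ s01] := rI _ sI'.
have [_ E1] := H; have [_ E2] := D _ s01.
have /eqP := E2; rewrite E1 eq_sym mulf_eq0 => /orP[|/eqP //].
by rewrite -normr_eq0 zfac_norm // invr_eq0 gt_eqF // mu_gt0.
Qed.

(* In the central zone the maximum of [|phi|] is attained at the origin, as the
   flux vanishes there and increases. *)
Lemma phi0_mu : `|phi 0| = mu 0.
Proof.
have im : (0 < m)%N := zones_m Z.
have [s0 sI smu smax] := phi_max im.
have z0 : zlo 0 < 0 < r 1 by have := zcrit_in im.
apply/eqP; rewrite eq_le smax //= -smu.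

rewrite -(@ler_pM2r _ (mu 0)^-1) ?invr_gt0 ?mu_gt0 // -!zfac_phiE //.
have rl : r 1 <= 1 by exact: r_le1.
have lo (t : R) : 0 <= t < r 1 -> zlo 0 < t < r 1.
  by rewrite /zlo /=; have := r_gt0; lra.
pose k := zfac 0.
have k1 : `|k| `^ (p - 1) * (zscale 0) `^ (2 + alpha) = 1.
  rewrite zfac_norm // /zscale -powRrM divfK; last by rewrite gt_eqF //; move: (alpha0); lra.
  by rewrite -powRM ?invr_ge0 ?ltW ?mu_gt0 // mulVf ?lt0r_neq0 ?mu_gt0 // powR1.
have fd (t : R) : 0 < t < r 1 -> is_derive t 1 (flux n (fun t => k * dphi t))
    (t `^ (n - 1) * t `^ alpha * (`|phi t| `^ (p - 1) * (k * phi t))).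
  move=> tr; have tL : 0 < t < 1 by lra.
  have H := flux_der phi_ode tL.
  have -> : flux n (fun t => k * dphi t) = (fun t => k * flux n dphi t).
    by apply/funext => x; rewrite /flux; ring.
  eapply drv_eq; first by apply: (drv_mul (drv_cst _ _) H).
  by rewrite /=; ring.
have fc (t : R) : 0 <= t < r 1 -> {for t, continuous (flux n (fun t => k * dphi t))}.
  move=> t0; have t1 : `|t| < 1 by rewrite ger0_norm; lra.
  apply: cont_opp; apply: cont_mul.
    by apply: cont_normpowR; [move: (n3); lra|case/andP: t0].
  by apply: cont_mul; [exact: cont_cst|exact: dphi_cont].
have dneg (t : R) : 0 < t < r 1 -> k * dphi t <= 0.
  move=> /andP[t0 tr].
  have : flux n (fun t => k * dphi t) 0 <= flux n (fun t => k * dphi t) t.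
    apply: (drv_ndecr (ltW t0)
      (df := fun t => t `^ (n - 1) * t `^ alpha * (`|phi t| `^ (p - 1) * (k * phi t)))).
    - by move=> x xt; apply: fd; lra.
    - move=> x xt; have : 0 < k * phi x by apply: zfac_phi_gt0 => //; apply: lo; lra.
      move=> /ltW H; apply: mulr_ge0; first by rewrite mulr_ge0 ?powR_ge0.
      by apply: mulr_ge0 => //; exact: powR_ge0.
    - by apply: fc; lra.
    - by apply: fc; lra.
  rewrite /flux dphi0 !mulr0 oppr0 oppr_ge0 pmulr_rle0 // powR_gt0 // normr_gt0 gt_eqF //.
apply: (drv_nincr s0 (f := fun t => k * phi t) (df := fun t => k * dphi t)).
- move=> x xs; have x01 : 0 < x < 1 by have /andP[_ ] := sI; lra.
  have [V1 _] := phi_ode x01.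
  eapply drv_eq; first by apply: (drv_mul (drv_cst _ _) V1).
  by rewrite /= mulr0 addr0.
- by move=> x xs; apply: dneg; have /andP[_ ] := sI; lra.
- by apply: cont_mul; [exact: cont_cst|apply: phi_cont; rewrite normr0].
- apply: cont_mul; first exact: cont_cst.
  by apply: phi_cont; apply: ltW; exact: (zlo_bnd im sI).
Qed.

Lemma dphi_zcrit i : (i < m)%N -> dphi (zcrit i) = 0.
Proof. by move=> im; rewrite /zcrit; case: eqP => // /eqP i0; exact: dphi_sigma. Qed.

Lemma phi_zcrit i : (i < m)%N -> `|phi (zcrit i)| = mu i.
Proof.
move=> im; rewrite /zcrit; case: eqP => [->|_]; first exact: phi0_mu.
by have [] := phi_max im.
Qed.

Lemma zscaleK i t : (i < m)%N -> t * zscale i / zscale i = t.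
Proof. by move=> im; rewrite mulfK // gt_eqF // zscale_gt0. Qed.

Lemma zV_cont i t : (i < m)%N -> `|t| <= 1 -> {for (t * zscale i), continuous (zV i)}.
Proof.
move=> im t1; apply: cont_mul; first exact: cont_cst.
apply: (cont_comp (f := fun t => t / zscale i)).
  by apply: cont_mul; [exact: cont_id|exact: cont_cst].
by rewrite zscaleK //; exact: phi_cont.
Qed.

Lemma zdV_cont i t : (i < m)%N -> `|t| < 1 -> {for (t * zscale i), continuous (zdV i)}.
Proof.
move=> im t1; apply: cont_mul; first exact: cont_cst.
apply: (cont_comp (f := fun t => t / zscale i)).
  by apply: cont_mul; [exact: cont_id|exact: cont_cst].
by rewrite zscaleK //; exact: dphi_cont.
Qed.

Lemma zone_hump i : (i < m)%N ->
  hump n alpha p (zscale i) (zV i) (zdV i) (zcrit i * zscale i) (r i.+1 * zscale i).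
Proof.
move=> im; have zs := zscale_gt0 im; have zI := zcrit_in im; have /andP[zl zr] := zI.
have rl : r i.+1 <= 1 by exact: r_le1.
have rp : 0 < r i.+1 by exact: r_pos.
split.
- by rewrite mulr_ge0 ?zcrit_ge0 // ltW.
- by rewrite ltr_pM2r.
- by rewrite ger_pMl.
- exact: zV_ode.
- by rewrite /zV zscaleK // zfac_phiE // phi_zcrit // divff // gt_eqF // mu_gt0.
- by rewrite /zdV zscaleK // dphi_zcrit // mulr0.
- move=> t /andP[st tb].
  have t0 : zcrit i <= t / zscale i by rewrite ler_pdivlMr.
  have t1 : t / zscale i < r i.+1 by rewrite ltr_pdivrMr.
  have tI : zlo i < t / zscale i < r i.+1 by rewrite (lt_le_trans zl t0).
  by rewrite zfac_phi_gt0 // zfac_phi_le1 // (le_trans _ t0) // zcrit_ge0.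
- rewrite /zV zscaleK // (phi_zeros _).2 ?mulr0 //; first by rewrite gtr0_norm.
  by exists i.+1; rewrite ?im // gtr0_norm.
- by apply: zV_cont => //; apply: ltW; exact: (zlo_bnd im zI).
- by apply: zdV_cont => //; exact: (zlo_bnd im zI).
- by apply: zV_cont => //; rewrite gtr0_norm.
Qed.

End Zones.

(** * Induction over the zones as the exponent tends to its critical value *)

Section Induction.
Context {R : realType} (n alpha : R) (m : nat) (phi dphi : R -> R -> R).
Variables (r mu sigma : R -> nat -> R).
Hypotheses (n3 : 3 <= n) (alpha0 : 0 <= alpha).
Local Notation pcrit := (pcrit n alpha).
Hypothesis Z : forall p, 1 < p < pcrit ->
  radial_zones n alpha p m (phi p) (dphi p) (r p) (mu p) (sigma p).

Local Notation scale p i := (zscale alpha p (mu p) i).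
Local Notation crit p i := (zcrit (sigma p) i).
Local Notation V p i := (zV alpha p (phi p) (mu p) (sigma p) i).
Local Notation dV p i := (zdV alpha p (phi p) (dphi p) (mu p) (sigma p) i).

Lemma zcrit_scale_small i (eps : R) : (i < m)%N -> 0 < eps ->
  exists2 d, 0 < d & forall p, 1 < p -> pcrit - d < p < pcrit ->
    crit p i * scale p i < eps.
Proof.
elim: i eps => [|i IH] eps im eps0.
  by exists 1 => // p p1 pP; rewrite /zcrit eqxx mul0r.
have [d1 d10 H1] := next_extremum n3 alpha0 eps0.
have [d2 d20 H2] := IH d1 (ltnW im) d10.
exists (Num.min d1 d2); first by rewrite lt_min d10.
move=> p p1 /andP[pd pP].
have pd1 : pcrit - d1 < p.
  by apply: le_lt_trans pd; rewrite lerD2l lerN2 ge_min lexx.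
have pd2 : pcrit - d2 < p.
  by apply: le_lt_trans pd; rewrite lerD2l lerN2 ge_min lexx orbT.
have pp : 1 < p < pcrit by rewrite p1.
have Zp := Z pp; have im' := ltnW im.
have sc0 : 0 < scale p i := zscale_gt0 Zp im'.
have m0 := mu_gt0 Zp im'; have m0' := mu_gt0 Zp im.
have [s0 sI smu _] := zones_max Zp im.
have zE : zlo (r p) i.+1 = r p i.+1 by [].
rewrite zE in sI; have /andP[sl sr] := sI.
have := H1 p (scale p i) (V p i) (dV p i) (crit p i * scale p i)
  (r p i.+1 * scale p i) (r p i.+2 * scale p i) (sigma p i.+1 * scale p i) p1.
rewrite pd1 pP => /(_ isT).
have -> : crit p i * scale p i < d1 by apply: H2; rewrite ?pd2.
move=> /(_ isT (zone_hump n3 alpha0 Zp im')).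
rewrite !ltr_pM2r // sl sr => /(_ isT).
have -> : r p i.+2 * scale p i <= scale p i.
  by rewrite ger_pMl // (r_le1 Zp).
move=> /(_ isT) H.
(* Scales compose: seen from zone [i], the next extremum has height [mu (i+1) / mu i], and this
   ratio to the power [(p-1)/(2+alpha)] is the ratio of the two scales. *)
have E : sigma p i.+1 * scale p i * `|V p i (sigma p i.+1 * scale p i)| `^ ((p - 1) / (2 + alpha))
    = crit p i.+1 * scale p i.+1.
  rewrite /zV normrM (zfac_norm Zp im') (zscaleK Zp _ im') smu.
  rewrite powRM ?invr_ge0 ?(ltW m0) ?(ltW m0') // /zcrit /= /zscale.
  have -> : (mu p i)^-1 `^ ((p - 1) / (2 + alpha)) = (mu p i `^ ((p - 1) / (2 + alpha)))^-1.
    by rewrite -(powR_inv1 (ltW m0)) -powRrM mulN1r powRN.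
  field; by rewrite lt0r_neq0.
rewrite -E; apply: H.
- move=> t /andP[t1 t2].
  rewrite -normr_gt0 /zV normrM (zfac_norm Zp im') mulr_gt0 ?invr_gt0 // normr_gt0.
  apply: (zone_neq0 Zp im); rewrite zE ltr_pdivlMr // t1 /=.
  by rewrite ltr_pdivrMr.
- rewrite /zdV (zscaleK Zp _ im') (dphi_sigma Zp im) ?mulr0 //.
Qed.

Lemma zones_conv i (rho rad eps : R) : (i < m)%N -> 0 < rho -> 0 < rad -> 0 < eps ->
  exists2 d, 0 < d & forall p, 1 < p -> pcrit - d < p < pcrit ->
  [/\ crit p i * scale p i < rho, rad < r p i.+1 * scale p i &
   forall t, crit p i * scale p i <= t <= rad ->
    `|V p i t - Ub n alpha t| < eps /\ `|dV p i t - dUb n alpha t| < eps].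
Proof.
move=> im rho0 rad0 eps0.
have [d1 d10 H1] := hump_conv n3 alpha0 rad0 eps0.
have d' : 0 < Num.min rho d1 by rewrite lt_min rho0.
have [d2 d20 H2] := zcrit_scale_small im d'.
exists (Num.min d1 d2); first by rewrite lt_min d10.
move=> p p1 /andP[pd pP].
have pd1 : pcrit - d1 < p.
  by apply: le_lt_trans pd; rewrite lerD2l lerN2 ge_min lexx.
have pd2 : pcrit - d2 < p.
  by apply: le_lt_trans pd; rewrite lerD2l lerN2 ge_min lexx orbT.
have := H2 p p1; rewrite pd2 pP => /(_ isT); rewrite lt_min => /andP[s1 s2].
have pp : 1 < p < pcrit by rewrite p1.
have pd1' : pcrit - d1 < p < pcrit by rewrite pd1.
by have [K1 K2] := H1 p _ _ _ _ _ p1 pd1' s2 (zone_hump n3 alpha0 (Z pp) im).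
Qed.

(** The outer zero of the rescaled zone exceeds any given radius and is at most the scale, as all
    zeros have radius at most 1. A large scale forces a large maximum because
    [(p-1)/(2+alpha) < 2/(n-2) <= 2]: if [mu <= A <= B], the scale would be at most [B^2], the
    radius chosen. *)
Lemma zone_scale_large i (A : R) : (i < m)%N ->
  exists2 d, 0 < d & forall p, 1 < p -> pcrit - d < p < pcrit ->
    A < scale p i /\ A < mu p i.
Proof.
move=> im; pose B := Num.max 1 A; have B1 : 1 <= B by rewrite le_max lexx.
have AB : A <= B by rewrite le_max lexx orbT.
have B0 : 0 < B ^+ 2 by rewrite exprn_gt0 //; lra.
have [d d0 H] := zones_conv im ltr01 B0 ltr01.
exists d => // p p1 pP; have [_ K _] := H p p1 pP.
have pp : 1 < p < pcrit by rewrite p1; case/andP: pP.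
have Zp := Z pp; have sc0 := zscale_gt0 Zp im.
have {}K : B ^+ 2 < scale p i.
  by apply: lt_le_trans K _; rewrite ger_pMl // (r_le1 Zp).
have BB : B <= B ^+ 2 by rewrite expr2 ler_peMr //; lra.
split; first by lra.
rewrite ltNge; apply/negP => muA.
have m0 := mu_gt0 Zp im.
have e0 : 0 <= (p - 1) / (2 + alpha).
  by rewrite divr_ge0 //; [lra|move: (alpha0); lra].
have e2 : (p - 1) / (2 + alpha) <= 2.
  have /andP[_ pP'] := pP; rewrite ler_pdivrMr; last by move: (alpha0); lra.
  have : pcrit - 1 <= 2 * (2 + alpha); last by lra.
  have -> : pcrit - 1 = (2 + alpha) * (2 / (n - 2)).
    by rewrite /pcrit; field; rewrite gt_eqF //; move: (n3); lra.
  rewrite mulrC ler_wpM2r //; first by move: (alpha0); lra.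
  by rewrite ler_pdivrMr; move: (n3); lra.
have : scale p i <= B ^+ 2.
  apply: (@le_trans _ _ (B `^ ((p - 1) / (2 + alpha)))).
    by apply: (ge0_ler_powR e0); rewrite ?nnegrE; lra.
  by rewrite -powR_mulrn ?ler_powR //; lra.
by rewrite leNgt K.
Qed.

End Induction.

(** * Convergence of the rescaled solutions *)

(** By Caratheodory's criterion with slope [|t|^(a-1) sg t]; it gives the derivative of the limit
    profile at the origin, where the rule for powers of a positive base does not apply. *)
Lemma drv_normpowR0 {R : realType} (a : R) : 2 <= a ->
  is_derive (0:R) 1 (fun t : R => `|t| `^ a) 0.
Proof.
move=> a2; have a0 : a != 0 by rewrite gt_eqF //; lra.
have b0 : a - 1 != 0 by rewrite gt_eqF //; lra.
apply/is_derive1_caratheodory; exists (fun t => `|t| `^ (a - 1) * Num.sg t); split.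
- move=> z; rewrite normr0 powR0 // !subr0 -mulrA -normrEsg.
  have [->|z0] := eqVneq z 0; first by rewrite normr0 powR0 // mulr0.
  by rewrite powRP1 ?normr_gt0 // divfK // normr_eq0.
- apply/cont_epsP => e e0.
  have a1 : 1 <= a - 1 by lra.
  have /cont_epsP/(_ e e0)[d d0 H] := cont_normpowR0 a1.
  exists d => // y yd; rewrite normr0 powR0 // mul0r subr0 normrM.
  have := H y yd; rewrite normr0 powR0 // subr0; apply: le_lt_trans.
  by rewrite ler_piMr // normr_sg; case: (y != 0).
- by rewrite sgr0 mulr0.
Qed.

Section Limit.
Context {R : realType} {N : nat} (alpha : R).
Hypotheses (n3 : 3 <= N%:R :> R) (alpha0 : 0 <= alpha).
Local Notation Ub := (Ub N%:R alpha).
Local Notation dUb := (dUb N%:R alpha).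

Lemma Ub_der0 : is_derive (0:R) 1 Ub 0.
Proof.
have a2 : 2 <= 2 + alpha by move: (alpha0); lra.
have H := drv_normpowR0 a2.
have X0 : 0 < Xb N%:R alpha 0 by exact: Xb_gt0.
have D : is_derive (0:R) 1 (Xb N%:R alpha) 0.
  eapply drv_eq; first by apply: (drv_add (drv_cst _ _) (drv_mul H (drv_cst _ _))).
  by rewrite !mulr0 !addr0.
eapply drv_eq; first exact: (drv_powR _ X0 D).
by rewrite mulr0.
Qed.

Lemma U_alphaE (x : 'rV[R]_N) : U_alpha alpha x = Ub (enorm x).
Proof. by rewrite /Ub /Xb ger0_norm ?enorm_ge0. Qed.

Lemma U_alpha_D (x : 'rV[R]_N) (j : 'I_N) : x != 0 ->
  'D_(evec R j) (@U_alpha R N alpha) x = dUb (enorm x) * (x ord0 j / enorm x).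
Proof.
move=> xn0; have ex0 : 0 < enorm x.
  rewrite lt_neqAle enorm_ge0 andbT eq_sym; apply/eqP => /enorm_eq0 x0.
  by rewrite x0 eqxx in xn0.
by have [_ ->] := radial_is_derive j U_alphaE xn0 (Ub_der n3 alpha0 ex0).
Qed.

Lemma U_alpha_D0 (j : 'I_N) : 'D_(evec R j) (@U_alpha R N alpha) 0 = 0.
Proof.
suff [_ ->] : is_derive (0 : 'rV[R]_N) (evec R j) (@U_alpha R N alpha) 0 by [].
apply: radial_is_derive0.
have -> : (fun s : R => U_alpha alpha (s *: evec R j)) = Ub; last exact: Ub_der0.
by apply/funext => s; rewrite U_alphaE enormZ_evec /Ub /Xb normr_id.
Qed.
End Limit.

Lemma annulusE {R : realType} {N : nat} (r : nat -> R) i (x : 'rV[R]_N) :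
  0 < r 1 -> nodal_annulus r i x <-> zlo r i < enorm x < r i.+1.
Proof.
rewrite /nodal_annulus /zlo => r1; case: eqP => [->|//] /=.
by have := enorm_ge0 x; split => [?|]; lra.
Qed.

Section Rescaled.
Context {R : realType} {N : nat} (i0 : 'I_N) (alpha p : R) (m : nat).
Variables (u : 'rV[R]_N -> R) (r mu sigma : nat -> R).
Hypotheses (n3 : 3 <= N%:R :> R) (alpha0 : 0 <= alpha).
Hypotheses (usol : dirichlet_solution alpha p u) (urad : radial u).
Local Notation phi := (profile i0 u).
Local Notation dphi := (dprofile i0 u).
Hypothesis Z : radial_zones N%:R alpha p m phi dphi r mu sigma.
Local Notation scale := (zscale alpha p mu).
Local Notation V := (zV alpha p phi mu sigma).
Local Notation dV := (zdV alpha p phi dphi mu sigma).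

Definition rescaled (i : nat) (x : 'rV[R]_N) : R :=
  (mu i)^-1 * `|u ((scale i)^-1 *: x)|.

Lemma rescaled_radial i x : (i < m)%N ->
  rescaled i x = (mu i)^-1 * `|phi (enorm x / scale i)|.
Proof.
move=> im; have sc0 := zscale_gt0 Z im.
have si : `|(scale i)^-1| = (scale i)^-1 by rewrite gtr0_norm // invr_gt0.
by rewrite /rescaled (profile_enorm i0 urad) enormZ si (mulrC (scale i)^-1).
Qed.

Lemma in_zone i t : (i < m)%N -> zlo r i < t / scale i < r i.+1 ->
  (mu i)^-1 * `|phi (t / scale i)| = V i t.
Proof. by move=> im tI; rewrite /zV (zfac_phiE Z im tI) mulrC. Qed.

Lemma in_zone_near i t : (i < m)%N -> zlo r i < t / scale i < r i.+1 ->
  \forall s \near t, (mu i)^-1 * `|phi (s / scale i)| = V i s.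
Proof.
move=> im /andP[t1 t2]; have sc0 := zscale_gt0 Z im.
rewrite ltr_pdivlMr // in t1; rewrite ltr_pdivrMr // in t2.
apply: filterS2 (lt_nbhsr t1) (lt_nbhsl t2) => s s1 s2.
by apply: in_zone => //; rewrite ltr_pdivlMr // s1 ltr_pdivrMr.
Qed.

Lemma rescaled_D i x (j : 'I_N) : (i < m)%N -> x != 0 ->
  zlo r i < enorm x / scale i < r i.+1 ->
  'D_(evec R j) (rescaled i) x = dV i (enorm x) * (x ord0 j / enorm x).
Proof.
move=> im xn0 xI; have sc0 := zscale_gt0 Z im.
have ex0 : 0 < enorm x.
  rewrite lt_neqAle enorm_ge0 andbT eq_sym; apply/eqP => /enorm_eq0 x0.
  by rewrite x0 eqxx in xn0.
have xL : 0 < enorm x < scale i.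
  have /andP[_] := xI; rewrite ltr_pdivrMr // => H; rewrite ex0 /=.
  by apply: lt_le_trans H _; rewrite ger_pMl // (r_le1 Z).
have [V1 _] := zV_ode alpha0 Z im xL.
have V2 : is_derive (enorm x) 1 (fun s => (mu i)^-1 * `|phi (s / scale i)|) (dV i (enorm x)).
  apply: drv_near V1; apply: filterS (in_zone_near im xI) => s; exact: esym.
by have [_ ->] := radial_is_derive j (fun z => rescaled_radial z im) xn0 V2.
Qed.

(** Near the origin the absolute value is a fixed multiple of the even profile, whose derivative
    vanishes at 0. *)
Lemma rescaled_D0 (j : 'I_N) : 'D_(evec R j) (rescaled 0) 0 = 0.
Proof.
have im := zones_m Z; have sc0 := zscale_gt0 Z im.
suff [_ ->] : is_derive (0 : 'rV[R]_N) (evec R j) (rescaled 0) 0 by [].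
apply: radial_is_derive0.
have zI : zlo r 0 < 0 / scale 0 < r 1.
  by rewrite mul0r; exact: (zcrit_in Z im).
have D : is_derive (0:R) 1 (fun t => t / scale 0) (scale 0)^-1.
  by eapply drv_eq; [der|rewrite /= mulr0 add0r mulr1].
have D1 : is_derive (0 / scale 0) 1 phi (dphi 0).
  have z1 : `|0 : R| < 1 by rewrite normr0.
  by rewrite mul0r; exact: (profile_der i0 usol z1).
have V1 : is_derive (0:R) 1 (V 0%N) 0.
  eapply drv_eq.
    by apply: (drv_mul (drv_cst _ _) (drv_comp (f := fun t => t / scale 0) D1 D)).
  by rewrite /= (zones_d0 Z) mul0r !mulr0 addr0.
apply: drv_near V1; apply: filterS (in_zone_near im zI) => s <-.
rewrite rescaled_radial // enormZ_evec.
congr (_ * `|_|); have [s0|s0] := leP 0 s; first by rewrite ger0_norm.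
by rewrite ltr0_norm // mulNr profileN.
Qed.

(** Both gradients are radial derivatives times [x_j / |x|], a factor of modulus at most 1, so the
    one-dimensional estimate carries over. At [x = 0], allowed only in the central zone, both
    gradients vanish. *)
Lemma rescaled_close i x (eps : R) : (i < m)%N ->
  zlo r i < enorm x / scale i < r i.+1 -> (x = 0 -> i = 0%N) ->
  `|V i (enorm x) - Ub N%:R alpha (enorm x)| < eps ->
  `|dV i (enorm x) - dUb N%:R alpha (enorm x)| < eps ->
  [/\ nodal_annulus r i ((scale i)^-1 *: x),
     `|rescaled i x - U_alpha alpha x| < eps &
     forall j, `|'D_(evec R j) (rescaled i) x - 'D_(evec R j) (@U_alpha R N alpha) x| < eps].
Proof.
move=> im xI x0i h1 h2; have sc0 := zscale_gt0 Z im.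
have eps0 : 0 < eps := le_lt_trans (normr_ge0 _) h1.
split.
- by apply/(annulusE _ _ (zones_r1 Z)); rewrite enormZ gtr0_norm ?invr_gt0 // mulrC.
- rewrite U_alphaE (rescaled_radial x im) (in_zone im xI); exact: h1.
move=> j; have [x0|xn0] := eqVneq x 0.
  by rewrite x0 (U_alpha_D0 n3 alpha0) (x0i x0) rescaled_D0 subrr normr0.
rewrite (rescaled_D j im xn0 xI) (U_alpha_D n3 alpha0 j xn0) -mulrBl normrM.
apply: le_lt_trans h2; rewrite ler_piMr // normrM normfV (ger0_norm (enorm_ge0 _)).
have ex0 : 0 < enorm x.
  rewrite lt_neqAle enorm_ge0 andbT eq_sym; apply/eqP => /enorm_eq0 x0.
  by rewrite x0 eqxx in xn0.
by rewrite ler_pdivrMr // mul1r coord_le_enorm.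
Qed.
End Rescaled.

Lemma near_left {R : realType} (c d : R) (P : R -> Prop) : 1 < c -> 0 < d ->
  (forall p, 1 < p -> c - d < p < c -> P p) -> \forall p \near c^'-, P p.
Proof.
move=> c1 d0 H; near=> p; apply: H; first by near: p; exact: nbhs_left_gt.
apply/andP; split; near: p; last exact: nbhs_left_lt.
by apply: nbhs_left_gt; rewrite gtrBl.
Unshelve. all: by end_near. Qed.

Unset Implicit Arguments.

Theorem theorem1p2 (R : realType) (N m : nat) (alpha : R)
  (u : R -> 'rV[R]_N -> R) (r : R -> nat -> R) (mu sigma : R -> nat -> R) :
  (3 <= N)%N -> 0 <= alpha -> (1 <= m)%N ->
  let palpha : R := (N%:R + 2 + 2 * alpha) / (N%:R - 2) in
  (forall p, 1 < p < palpha ->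
    [/\ dirichlet_solution alpha p (u p), radial (u p) &
        (nodal_zones (u p) #= `I_m)%card] /\
    [/\
        (* radii of the zeros: 0 < r_1 < ... < r_m = 1 *)
        0 < r p 1%N, (forall i, (1 <= i < m)%N -> r p i < r p i.+1),
        r p m = 1,
        (forall x, enorm x <= 1 ->
           (u p x = 0 <-> exists2 i, (1 <= i <= m)%N & enorm x = r p i)) &
        (* mu_i = max of |u_p| on A_i, attained at radius sigma_i *)
        forall i, (i < m)%N ->
          (exists x, [/\ nodal_annulus (r p) i x, `|u p x| = mu p i &
                          enorm x = sigma p i]) /\
          (forall x, nodal_annulus (r p) i x -> `|u p x| <= mu p i)]) ->
  let mut p i := mu p i `^ ((p - 1) / (2 + alpha)) in
  let At p i := [set x : 'rV[R]_N | nodal_annulus (r p) i ((mut p i)^-1 *: x)] in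
  let ut i p x := (mu p i)^-1 * `|u p ((mut p i)^-1 *: x)| in
  [/\ (forall i, (i < m)%N -> (fun p => mu p i) @ palpha^'- --> +oo),
      C1loc_conv (palpha^'-) (fun p => At p 0%N) (ut 0%N) (@U_alpha R N alpha) &
      forall i, (1 <= i < m)%N ->
        [/\ (fun p => r p i) @ palpha^'- --> 0,
            (fun p => sigma p i) @ palpha^'- --> 0 &
            C1loc_conv_punct (palpha^'-) (fun p => At p i) (ut i)
              (@U_alpha R N alpha)]].
Proof.
move=> N3 alpha0 m1 palpha H mut At ut.
have n3 : 3 <= N%:R :> R by rewrite ler_nat.
pose i0 : 'I_N := Ordinal (leq_trans (isT : (0 < 3)%N) N3).
have Z p : 1 < p < pcrit N%:R alpha ->
    radial_zones N%:R alpha p m (profile i0 (u p)) (dprofile i0 (u p))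
      (r p) (mu p) (sigma p).
  move=> pp; have [[usol urad _] [r1 rincr rlast zeros hmax]] := H p pp.
  split => //.
  - by case/andP: pp.
  - exact: (profile_ode i0 usol urad).
  - exact: profile_cont usol.
  - exact: dprofile_cont usol.
  - exact: (dprofile0 i0 usol urad).
  - move=> t t1; have := zeros (t *: evec R i0); rewrite enormZ_evec; exact.
  - move=> i im; have [[x [xa xmu xs]] xmax] := hmax i im; split.
    + by rewrite -xs enorm_ge0.
    + by rewrite -xs; apply/(annulusE _ _ r1).
    + by rewrite -xs -(profile_enorm i0 urad).
    + move=> t t0 tI; apply: (xmax (t *: evec R i0)).
      by apply/(annulusE _ _ r1); rewrite enormZ_evec ger0_norm.
have pc1 : 1 < palpha by exact: pcrit_gt1.
split.
- move=> i im; apply/cvgryPge => A.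
  have [d d0 K] := zone_scale_large n3 alpha0 Z A im.
  by apply: (near_left pc1 d0) => p p1 /(K p p1)[_ /ltW].
- move=> rad eps rad0 eps0.
  have [d d0 K] := zones_conv n3 alpha0 Z m1 ltr01 rad0 eps0.
  apply: (near_left pc1 d0) => p p1 pP x xrad.
  have [_ K2 K3] := K p p1 pP.
  have pp : 1 < p < palpha by rewrite p1; case/andP: pP.
  have [[usol urad _] _] := H p pp.
  have sc0 := zscale_gt0 (Z p pp) m1.
  have x0 := enorm_ge0 x.
  have xI : zcrit (sigma p) 0 * zscale alpha p (mu p) 0 <= enorm x <= rad.
    by rewrite /zcrit eqxx mul0r x0.
  have [h1 h2] := K3 _ xI.
  apply: (rescaled_close n3 alpha0 usol urad (Z p pp)) => //.
  apply/andP; split; last by rewrite ltr_pdivrMr //; exact: le_lt_trans xrad K2.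
  have /andP[z1 _] := zcrit_in (Z p pp) m1; apply: lt_le_trans z1 _.
  by rewrite /zcrit eqxx divr_ge0 // ltW.
- move=> i /andP[i1 im].
  (* Once the scale exceeds 1, [r_i < sigma_i <= sigma_i * scale < eps], which gives both limits at
     once. *)
  have small eps : 0 < eps -> \forall p \near palpha^'-, 0 < r p i /\
      r p i < sigma p i < eps.
    move=> eps0; have [d1 d10 K1] := zone_scale_large n3 alpha0 Z 1 im.
    have [d2 d20 K2] := zcrit_scale_small n3 alpha0 Z im eps0.
    have dm : 0 < Num.min d1 d2 by rewrite lt_min d10.
    apply: (near_left pc1 dm) => p p1 /andP[pd pP].
    have pd1 : palpha - d1 < p.
      by apply: le_lt_trans pd; rewrite lerD2l lerN2 ge_min lexx.
    have pd2 : palpha - d2 < p.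
      by apply: le_lt_trans pd; rewrite lerD2l lerN2 ge_min lexx orbT.
    have pp : 1 < p < palpha by rewrite p1.
    have ppd1 : palpha - d1 < p < palpha by rewrite pd1.
    have ppd2 : palpha - d2 < p < palpha by rewrite pd2.
    have [s1 _] := K1 p p1 ppd1; have := K2 p p1 ppd2.
    have [s0 sI _ _] := zones_max (Z p pp) im.
    have i0' : (i == 0%N) = false by case: (i) i1.
    rewrite /zcrit i0'; move: sI; rewrite /zlo i0' => /andP[rs _] sm.
    have i1m : (1 <= i <= m)%N by rewrite i1 ltnW.
    split; first exact: (r_pos (Z p pp) i1m).
    rewrite rs /=; apply: le_lt_trans sm; rewrite ler_peMr //; exact: ltW.
  split.
  + apply/cvgrPdist_lt => eps eps0; apply: filterS (small eps eps0).
    move=> p [r0 /andP[rs se]]; rewrite sub0r normrN gtr0_norm //.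
    exact: lt_trans se.
  + apply/cvgrPdist_lt => eps eps0; apply: filterS (small eps eps0).
    move=> p [r0 /andP[rs se]]; rewrite sub0r normrN gtr0_norm //.
    exact: lt_trans rs.
  + move=> rho rad eps rho0 eps0.
    (* The punctured convergence puts no sign condition on [rad], whereas [zones_conv] needs a
       positive radius. *)
    have rad0 : 0 < Num.max rad 1 by rewrite lt_max ltr01 orbT.
    have [d d0 K] := zones_conv n3 alpha0 Z im rho0 rad0 eps0.
    apply: (near_left pc1 d0) => p p1 pP x /andP[xrho xrad].
    have [K1 K2 K3] := K p p1 pP.
    have pp : 1 < p < palpha by rewrite p1; case/andP: pP.
    have [[usol urad _] _] := H p pp.
    have sc0 := zscale_gt0 (Z p pp) im.
    have xrad' : enorm x <= Num.max rad 1 by rewrite le_max xrad.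
    have xI : zcrit (sigma p) i * zscale alpha p (mu p) i <= enorm x <= Num.max rad 1.
      by rewrite xrad' (le_trans (ltW K1)).
    have [h1 h2] := K3 _ xI.
    apply: (rescaled_close n3 alpha0 usol urad (Z p pp)) => //.
      apply/andP; split; last by rewrite ltr_pdivrMr //; exact: le_lt_trans xrad' K2.
      have /andP[z1 _] := zcrit_in (Z p pp) im; apply: lt_le_trans z1 _.
      by rewrite ler_pdivlMr // (le_trans (ltW K1)).
    move=> x0; move: xrho; rewrite x0 -(scale0r (evec R i0)) enormZ_evec normr0.
    by rewrite leNgt rho0.
Qed.
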